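(* Let $X$ be a separable metric space with its Borel $\sigma$-algebra, and let $(X_n)_{n\in\mathbb{N}}$ be a time-homogeneous Markov chain with state space $X$ and transition operator $\pi$, where $\pi u(x)=E_x(u(X_1))$. Suppose that for every bounded continuous function $u:X\to\mathbb{R}$ the map $x\mapsto \pi u(x)$ is continuous on $X$. Let $Y$ be a nonempty compact subset of $X$, and let $\widetilde Y$ be a Borel subset of $X$ such that $Y\subset\widetilde Y$ and $P_y(X_1\in\widetilde Y)=1$ for every $y\in Y$. Then for any closed convex subset $C$ of $\mathcal{M}(Y)$, $$\forall n\geq 1\qquad \inf_{x\in\widetilde Y}\,P_x\big(L_n^Y\in C\big)\,\leq\,\exp\Big(-n\,\inf_{\mu\in C}\,I(\mu)\Big)\,,$$ where $\mathcal{M}(Y)$, $L_n^Y$ and $I$ are as defined in the context.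
   Context: $P_x$ and $E_x$ denote probability and expectation for the Markov chain $(X_n)_{n\in\mathbb{N}}$ started at $X_0=x$. Local time: for $n\ge 1$ and $A\subset X$ Borel, $L_n(A)=\sum_{k=0}^{n-1}1_{\{X_k\in A\}}$. For $n\ge1$, $\tau(Y,n)=\inf\{k\geq 1: L_k(Y)=n\}$, which is $+\infty$ if the chain visits $Y$ strictly less than $n$ times. For $A$ a Borel subset of $Y$, $$L_n^Y(A)=\frac1n\sum_{k=0}^{\tau(Y,n)-1}1_{\{X_k\in A\}},$$ where the sum runs over all non-negative integers $k$ if $\tau(Y,n)=\infty$. Thus $L_n^Y$ is a random measure on $Y$; it is a probability measure exactly when $\tau(Y,n)<\infty$, so the event $\{L_n^Y\in C\}$ with $C\subset\mathcal{M}(Y)$ is contained in $\{\tau(Y,n)<\infty\}$. $\mathcal{M}(Y)$ is the set of Borel probability measures on $Y$, endowed with the topology of weak convergence. $\mathcal{S}^*(Y)$ is the collection of continuous functions $u:X\to\mathbb{R}$ such that (i) there exist $c_1,c_2\in\mathbb{R}$ with $0<c_1\leq u(y)\leq c_2$ for all $y\in X$; and (ii) $u(y)\geq\pi u(y)$ for all $y\in X\setminus Y$. For $\mu\in\mathcal{M}(Y)$, $$I(\mu)=-\inf_{u\in\mathcal{S}^*(Y)}\int_Y\ln\Big(\frac{\pi u}{u}\Big)(x)\,\mu(dx)\in[0,+\infty].$$ Conventions: $\inf\emptyset=+\infty$ and $\exp(-\infty)=0$. *)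

(* Defs.v *)
From HB Require Import structures.
From mathcomp Require Import all_boot all_order all_algebra.
From mathcomp Require Import all_classical all_reals all_analysis.
Set Implicit Arguments.
Unset Strict Implicit.
Unset Printing Implicit Defensive.
Import Order.TTheory GRing.Theory Num.Theory.
Import numFieldNormedType.Exports.
Local Open Scope classical_set_scope.
Local Open Scope ring_scope.

(* A metric and a sigma-algebra on the same carrier, a priori unrelated; they
   are tied together by [is_borel]. Measurable types are pointed, which is
   harmless for a space that has a nonempty subset. *)
#[short(type="measurableMetricType")]
HB.structure Definition MeasurableMetric (d : measure_display)
  (R : numDomainType) := {X of Metric R X & Measurable d X}.

Definition is_borel (d : measure_display) (R : realType)
    (X : measurableMetricType d R) : Prop :=
  (@measurable d X : set (set X)) = <<s (@open X : set (set X)) >>.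

Definition is_separable (T : topologicalType) : Prop :=
  exists2 D : set T, countable D & dense D.

Section markov_chain.
Context (d d' : measure_display) (R : realType) (X : measurableMetricType d R)
  (Omega : measurableType d').
Implicit Types (K : R.-pker X ~> X) (P : X -> probability Omega R)
  (Z : nat -> {mfun Omega >-> X}).

(* sigma(Z_0, ..., Z_n) *)
Definition past Z (n : nat) : set (set Omega) :=
  <<s \bigcup_(k in `I_n.+1) preimage_set_system setT (Z k) measurable >>.

(* Z_0 = x almost surely under P x, and P x (Z_(n+1) in B | Z_0, ..., Z_n) is
   K (Z_n) B; the conditional probability is characterized by its integrals
   over the events of the past. *)
Definition is_markov_chain K P Z : Prop :=
  (forall x, P x (Z 0%N @^-1` [set x]) = 1%E) /\
  (forall x n F B, past Z n F -> measurable B ->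
    P x (F `&` Z n.+1 @^-1` B) = \int[P x]_(w in F) K (Z n w) B)%E.

Definition transition_op P Z (u : X -> R) (x : X) : R :=
  fine 'E_(P x)[u \o Z 1%N].

Definition local_time Z (n : nat) (A : set X) (w : Omega) : R :=
  \sum_(0 <= k < n) \1_A (Z k w).

Definition tau Z (Y : set X) (n : nat) (w : Omega) : \bar R :=
  ereal_inf [set k%:R%:E | k in
    [set k | (1 <= k)%N /\ local_time Z k Y w = n%:R]].

Definition trace_occupation Z (Y : set X) (n : nat) (A : set X) (w : Omega)
    : \bar R :=
  (n%:R^-1%:E * \sum_(0 <= k <oo | k%:R%:E < tau Z Y n w)
                  (\1_A (Z k w))%:E)%E.

End markov_chain.

Section probability_measures_on_subset.
Context (d : measure_display) (R : realType) (X : measurableMetricType d R).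

(* For a Borel set Y, the Borel sigma-algebra of the subspace Y is the trace of
   that of X: Borel probability measures on Y are identified with the Borel
   probability measures on X giving mass 1 to Y. *)
Definition prob_on (Y : set X) : Type :=
  set_type [set mu : pprobability X R | mu Y = 1%E].

Definition prob_on_val (Y : set X) (mu : prob_on Y) : probability X R :=
  set_val mu.

(* For compact Y, the restrictions to Y of the functions f below are exactly
   the bounded continuous functions on the subspace Y. *)
Definition test_fun (Y : set X) : Type :=
  {f : X -> R | {within Y, continuous f}}.

Definition test_integrals (Y : set X) (mu : prob_on Y)
    : prod_topology (fun _ : test_fun Y => R : topologicalType) :=
  fun f => (\int[prob_on_val mu]_(x in Y) sval f x)%R.

(* The topology of weak convergence: the coarsest one for which
   mu |-> \int_Y f dmu is continuous for every test function f. *)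
HB.instance Definition _ (Y : set X) := Choice.on (prob_on Y).
HB.instance Definition _ (Y : set X) :=
  Topological.copy (prob_on Y) (initial_topology (@test_integrals Y)).

Definition convex_prob (Y : set X) (C : set (prob_on Y)) : Prop :=
  forall (mu nu rho : prob_on Y) (t : R), 0 <= t <= 1 -> C mu -> C nu ->
    (forall A, measurable A -> prob_on_val rho A =
      t%:E * prob_on_val mu A + (1 - t)%:E * prob_on_val nu A)%E ->
    C rho.

Definition S_star (pi : (X -> R) -> X -> R) (Y : set X) : set (X -> R) :=
  [set u | [/\ continuous u,
     exists c1 c2 : R, 0 < c1 /\ forall y, c1 <= u y <= c2 &
     forall y, ~ Y y -> pi u y <= u y]].

Definition rate (pi : (X -> R) -> X -> R) (Y : set X) (mu : prob_on Y)
    : \bar R :=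
  (- ereal_inf [set \int[prob_on_val mu]_(x in Y) (ln (pi u x / u x))%:E
               | u in S_star pi Y])%E.

End probability_measures_on_subset.

(* The equation for A = Y forces tau to be finite on this event. *)
Definition occupation_in (d d' : measure_display) (R : realType)
    (X : measurableMetricType d R) (Omega : measurableType d')
    (Z : nat -> {mfun Omega >-> X}) (Y : set X) (n : nat)
    (C : set (prob_on Y)) : set Omega :=
  [set w | exists2 mu : prob_on Y, C mu &
     forall A, measurable A -> A `<=` Y ->
       trace_occupation Z Y n A w = prob_on_val mu A].

(* Main.v *)
Require Import Defs.
From HB Require Import structures.
From mathcomp Require Import all_boot all_order all_algebra.
From mathcomp Require Import all_classical all_reals all_analysis.
From mathcomp Require Import measurable_realfun ring lra.
Set Implicit Arguments.
Unset Strict Implicit.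
Unset Printing Implicit Defensive.
Import Order.TTheory GRing.Theory Num.Theory.
Import numFieldNormedType.Exports.
Local Open Scope classical_set_scope.
Local Open Scope ring_scope.

(* Let u be in S*(Y), sigma the time of the n-th visit to Y (so that
   tau(Y,n) = sigma + 1), and let V_t be the product of u(X_t) with the factors
   (u / pi u)(X_k) over the visits k < t. Since pi u <= u off Y, V is a nonnegative
   supermartingale, and at time sigma it equals
     pi u(X_sigma) * exp(n * int ln(u / pi u) dL_n).
   As pi u >= inf_Yt u on Y, this gives
     (inf_Yt u) * exp(n a) * P_x(L_n in C) <= u(x)
   whenever a <= int ln(u / pi u) dmu on C, and letting u(x) tend to inf_Yt u
   yields inf_x P_x(L_n in C) <= exp(-n a): no constant is left, so no
   subadditivity argument is needed. The integral is affine in mu and concave in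
   ln u, and C is compact, so a minimax argument exchanges inf_C and sup_u.
   Compactness of M(Y) comes from ultrafilter limits: the limits of the masses of
   compact sets form a content, whose outer measure is a Borel measure. *)

(** * Compactness of the space of probability measures *)

(** Each function u gives one bound valid on all of C, whereas I(mu) lets u depend on mu; only a
    minimax closes this gap. What makes it available is stability of [S_star] under weighted
    geometric means: [pi] satisfies Hölder's inequality, so exp of a convex combination of the ln u
    is again admissible, and ln(u / pi u) at this mean dominates the combination of the individual
    values. The ultrafilter limit of the masses need not be countably additive, so it is read on
    compact sets only and replaced there by a genuine measure that dominates it. Domination
    suffices: superlevel sets of a continuous f on Y are compact, which bounds the limit of the
    integrals of f by the integral against the new measure, and the same bound for -f gives
    equality. The event itself is a further obstacle: it asks for a member of C, a set known only to
    be closed for the weak topology. Its measurability is obtained path by path, from stability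
    under limits with a fixed pattern of visits to Y and from a countable family of cylinders
    supplied by separability. *)

Section weak_topology.
Context (d : measure_display) (R : realType) (X : measurableMetricType d R).
Variable Y : set X.

(** The topology is initial for a map into a product, so convergence splits into coordinates. An
    arbitrary filter is allowed because the lemma serves neighbourhoods, ultrafilters and sequences
    alike. *)
Lemma cvg_test_integralsP (F : set_system (prob_on Y)) (mu : prob_on Y) :
  Filter F ->
  (F --> mu) <-> forall f : test_fun Y,
    (test_integrals nu f : R) @[nu --> F] --> (test_integrals mu f : R).
Proof.
move=> FF; split=> [Fmu f|h].
- have c1 : {for mu, continuous (@test_integrals d R X Y)}.
    exact: initial_continuous.
  have /cvg_sup/(_ f) tF := cvg_comp _ _ Fmu c1.
  exact: cvg_comp tF (@initial_continuous _ _ _ _).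
- have tF : test_integrals nu @[nu --> F] --> test_integrals mu.
    apply/cvg_sup => f A /= [_ [[B oB <-] Bmu BA]].
    rewrite nbhs_filterE; apply: filterS BA _.
    by apply: (h f); exact: open_nbhs_nbhs.
  move=> A /= [_ [[B oB <-] Bmu BA]].
  rewrite nbhs_filterE; apply: filterS BA _.
  by apply: tF; exact: open_nbhs_nbhs.
Qed.

Lemma continuous_test_integrals (f : test_fun Y) :
  continuous (fun mu : prob_on Y => test_integrals mu f : R).
Proof.
move=> mu; have FF : Filter (nbhs mu) := nbhs_filter mu.
by apply: (iffLR (cvg_test_integralsP mu FF)).
Qed.

End weak_topology.

(** * From a content on compact sets to a Borel probability measure *)

Section content_measure.
Context (d : measure_display) (R : realType) (X : measurableMetricType d R).
Variable nu : set X -> R.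
Hypothesis nu_ge0 : forall K, compact K -> 0 <= nu K.
Hypothesis nu_le1 : forall K, compact K -> nu K <= 1.
Hypothesis nuU : forall K L, compact K -> compact L ->
  nu (K `|` L) <= nu K + nu L.
Hypothesis nuD : forall K L, compact K -> compact L -> K `&` L = set0 ->
  nu K + nu L <= nu (K `|` L).

Local Open Scope ereal_scope.

Let hX : hausdorff_space X := @metric_hausdorff R X.

Definition inner_content (U : set X) : \bar R :=
  ereal_sup [set (nu K)%:E | K in [set K | compact K /\ K `<=` U]].

Definition outer_content (A : set X) : \bar R :=
  ereal_inf [set inner_content U | U in [set U | open U /\ A `<=` U]].

Lemma inner_content_ge K U : compact K -> K `<=` U -> (nu K)%:E <= inner_content U.
Proof. by move=> cK KU; apply: ereal_sup_ubound; exists K. Qed.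

Lemma inner_content_le U e :
  (forall K, compact K -> K `<=` U -> (nu K)%:E <= e) -> inner_content U <= e.
Proof. by move=> h; apply: ge_ereal_sup => _ [K [cK KU] <-]; exact: h. Qed.

Lemma inner_content_ge0 U : 0 <= inner_content U.
Proof.
apply: le_trans (inner_content_ge (@compact0 X) (@sub0set _ U)).
by rewrite lee_fin nu_ge0//; exact: compact0.
Qed.

Lemma inner_content_le1 U : inner_content U <= 1.
Proof. by apply: inner_content_le => K cK _; rewrite lee_fin nu_le1. Qed.

(** For a compact K inside the union, [K \ U] and [K \ V] are disjoint closed sets. Normality
    separates them by disjoint open sets U' and V', and K is then the union of the compact sets
    [K \ U'], contained in U, and [K \ V'], contained in V. *)
Lemma inner_contentU U V : open U -> open V ->
  inner_content (U `|` V) <= inner_content U + inner_content V.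
Proof.
move=> oU oV; apply: inner_content_le => K cK KUV.
have cD W : open W -> compact (K `\` W).
  by move=> oW; rewrite setDE; apply: compact_closedI => //; exact: open_closedC.
have [U' [V' [oU' oV' KU KV UV']]] : exists U' V', [/\ open U', open V',
    K `\` U `<=` U', K `\` V `<=` V' & U' `&` V' = set0].
  have /(@normal_openP R) := @pseudometric_normal R X; apply => //.
  - by apply: compact_closed => //; exact: cD.
  - by apply: compact_closed => //; exact: cD.
  - rewrite -subset0 => x [[Kx nU] [_ nV]].
    by have [] := KUV _ Kx.
have -> : K = (K `\` U') `|` (K `\` V').
  rewrite -setDIr UV' setD0//.
apply: (@le_trans _ _ (nu (K `\` U') + nu (K `\` V'))%:E).
  by rewrite lee_fin nuU//; exact: cD.
rewrite EFinD leeD//; apply: inner_content_ge; try exact: cD.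
- by move=> x [Kx nU']; apply: contrapT => nU; apply: nU'; exact: KU.
- by move=> x [Kx nV']; apply: contrapT => nV; apply: nV'; exact: KV.
Qed.

Lemma inner_content_bigcup (U : (set X)^nat) : (forall n, open (U n)) ->
  inner_content (\bigcup_n U n) <= \sum_(n <oo) inner_content (U n).
Proof.
move=> oU; apply: inner_content_le => K cK KU.
have [D _ KD] : finite_subset_cover [set: nat] U K.
  by move: cK; rewrite compact_cover; apply.
pose N := (\max_(i <- finmap.enum_fset D) i).+1.
have oN n : open (\big[setU/set0]_(i < n) U i).
  by rewrite -bigcup_mkord; apply: bigcup_open.
have {KD} KN : K `<=` \big[setU/set0]_(i < N) U i.
  move=> x /KD[i /= iD Uix]; rewrite -bigcup_mkord; exists i => //=.
  by rewrite /N ltnS; exact: leq_bigmax_seq.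
apply: le_trans (inner_content_ge cK KN) _.
apply: (@le_trans _ _ (\sum_(i < N) inner_content (U i))); last first.
  rewrite -(big_mkord xpredT (fun i => inner_content (U i))).
  by apply: nneseries_lim_ge => n _ _; exact: inner_content_ge0.
elim: N {KN} => [|n IH].
  rewrite !big_ord0; apply: inner_content_le => L cL; rewrite subset0 => ->.
  (* Superadditivity on two copies of the empty set gives [2 nu set0 <= nu set0], hence
     [nu set0 <= 0]. *)
  have := nuD (@compact0 X) (@compact0 X) (@setI0 _ set0).
  by rewrite setU0 lee_fin; lra.
rewrite !big_ord_recr/=; apply: le_trans (inner_contentU _ _) _ => //.
  exact: oN.
by apply: leeD => //; exact: IH.
Qed.

Lemma outer_content_le A U : open U -> A `<=` U ->
  outer_content A <= inner_content U.
Proof. by move=> oU AU; apply: ereal_inf_lbound; exists U. Qed.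

Lemma outer_content_ge A e : (forall U, open U -> A `<=` U -> e <= inner_content U) ->
  e <= outer_content A.
Proof. by move=> h; apply: le_ereal_inf_tmp => _ [U [oU AU] <-]; exact: h. Qed.

Lemma outer_content_ge0 A : 0 <= outer_content A.
Proof. by apply: outer_content_ge => U _ _; exact: inner_content_ge0. Qed.

Lemma outer_content_le1 A : outer_content A <= 1.
Proof.
exact: le_trans (outer_content_le openT (@subsetT _ A)) (inner_content_le1 _).
Qed.

Lemma outer_content_fin A : outer_content A \is a fin_num.
Proof.
by rewrite ge0_fin_numE ?outer_content_ge0// (le_lt_trans (outer_content_le1 _))// ltry.
Qed.

Lemma outer_contentS : {homo outer_content : A B / A `<=` B >-> A <= B}.
Proof.
move=> A B AB; apply: outer_content_ge => U oU BU.
by apply: outer_content_le => //; exact: subset_trans BU.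
Qed.

Lemma outer_content0 : outer_content set0 = 0.
Proof.
apply/eqP; rewrite eq_le outer_content_ge0 andbT.
apply: le_trans (outer_content_le (@open0 X) (@subset_refl _ _)) _.
apply: inner_content_le => L cL; rewrite subset0 => ->.
have := nuD (@compact0 X) (@compact0 X) (@setI0 _ set0).
by rewrite setU0 lee_fin; lra.
Qed.

Lemma outer_content_sigma_subadditive : sigma_subadditive outer_content.
Proof.
move=> F; apply/lee_addgt0Pr => e e0.
have /choice[U hU] n : exists U, [/\ open U, F n `<=` U &
    inner_content U <= outer_content (F n) + (e / (2 ^ n.+1)%:R)%:E].
  have e'0 : (0 < e / (2 ^ n.+1)%:R)%R by rewrite divr_gt0// ltr0n expn_gt0.
  have [_ [U [oU FU] <-] lt] := lb_ereal_inf_adherent e'0 (outer_content_fin (F n)).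
  by exists U; split => //; exact: ltW.
have oU n : open (U n) by have [] := hU n.
apply: (@le_trans _ _ (inner_content (\bigcup_n U n))).
  apply: outer_content_le; first exact: bigcup_open.
  by apply: subset_bigcup => n _; have [] := hU n.
apply: le_trans (inner_content_bigcup oU) _.
apply: (@le_trans _ _ (\sum_(n <oo) (outer_content (F n) + (e / (2 ^ n.+1)%:R)%:E))).
  apply: lee_nneseries => n _ => [_|]; first exact: inner_content_ge0.
  by have [] := hU n.
by apply: epsilon_trick => //; [move=> n; exact: outer_content_ge0|exact: ltW].
Qed.

(** For an open V containing A and a compact K in [V & U], the open set [V \ K] contains [V \ U]. A
    compact L in [V \ K] is disjoint from K, so superadditivity bounds [nu L + nu K] by the inner
    content of V; it remains to take suprema over L, then over K. *)
Lemma outer_content_caratheodory U : open U -> forall A,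
  outer_content (A `&` U) + outer_content (A `&` ~` U) <= outer_content A.
Proof.
move=> oU A; apply: outer_content_ge => V oV AV.
apply: (@le_trans _ _ (inner_content (V `&` U) + outer_content (V `&` ~` U))).
  apply: leeD; last by apply: outer_contentS; exact: setSI.
  by apply: outer_content_le; [exact: openI|exact: setSI].
rewrite -leeBrDr ?outer_content_fin//; apply: inner_content_le => K cK KVU.
have oK : open (~` K) by apply: closed_openC; exact: compact_closed.
rewrite leeBrDr ?outer_content_fin// addeC -leeBrDr//.
apply: (@le_trans _ _ (inner_content (V `&` ~` K))).
  apply: outer_content_le; first exact: openI.
  by apply: setIS; apply: subsetC => x /KVU[].
apply: inner_content_le => L cL LV; rewrite leeBrDr// -EFinD.
apply: (@le_trans _ _ (nu (L `|` K))%:E).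
  rewrite lee_fin nuD// -subset0 => x [/LV[_ nK] Kx]; exact: nK.
apply: inner_content_ge; first exact: compactU.
by move=> x [/LV[]//|/KVU[]].
Qed.

(** Open sets are Carathéodory measurable, hence so are all Borel sets. Every open set containing K
    has inner content at least [nu K], which gives the domination; total mass one comes from K0. *)
Lemma content_probability K0 : is_borel X -> compact K0 -> nu K0 = 1%R ->
  exists mu : probability X R, forall K, compact K -> (nu K)%:E <= mu K.
Proof.
move=> bX cK0 nuK0.
pose om : {outer_measure set X -> \bar R} := HB.pack outer_content
  (isOuterMeasure.Build R X outer_content outer_content0 outer_content_ge0
    outer_contentS outer_content_sigma_subadditive).
have mom : (@measurable d X) `<=` om.-cara.-measurable.
  rewrite bX; apply: smallest_sub; first exact: sigma_algebra_measurable.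
  move=> U oU; apply: le_caratheodory_measurable.
  exact: outer_content_caratheodory.
have sa : semi_sigma_additive (outer_content : set X -> \bar R).
  move=> F mF tF mUF.
  apply: (@caratheodory_measure_sigma_additive R X om F) => //.
    by move=> n; exact: mom.
  exact: mom.
pose m : {measure set X -> \bar R} := HB.pack outer_content
  (isMeasure.Build d X R outer_content outer_content0 outer_content_ge0 sa).
have m1 : m setT = 1.
  apply/eqP; rewrite eq_le outer_content_le1 -nuK0/=.
  by apply: outer_content_ge => U oU TU; apply: inner_content_ge => // x _; exact: TU.
pose p : probability X R := HB.pack (m : set X -> \bar R) m
  (Measure_isProbability.Build d X R m m1).
exists p => K cK; apply: outer_content_ge => U oU KU; exact: inner_content_ge.
Qed.

End content_measure.

(** The segment is compact, so the image filter has a cluster point; the image of an ultrafilter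
    decides every set, which turns a cluster point into a limit. *)
Lemma ultra_bounded_cvg (R : realType) (T : Type) (F : set_system T)
    (f : T -> R) (a b : R) : UltraFilter F ->
  (forall t, a <= f t <= b) -> exists l : R, f t @[t --> F] --> l.
Proof.
move=> FU fab; have PF := @ultra_proper _ _ FU.
have PfF : ProperFilter (f @ F) by exact: fmap_proper_filter.
have [|l [_ cl]] := @segment_compact R a b _ PfF.
  have -> : (f @ F) `[a, b]%classic = F setT.
    by congr F; apply/seteqP; split => // t _; rewrite /= in_itv/=; exact: fab.
  exact: filterT.
exists l => A lA.
have [//|FA] := in_ultra_setVsetC (f @^-1` A) FU.
by have [y [nAy Ay]] := cl (~` A) A FA lA.
Qed.

(** The sum counts the integers from 1 to N that are at most t, so it is the integer part of t: a
    discrete layer-cake formula. *)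
Lemma sum_indic_levels (R : realType) (t : R) (N : nat) : 0 <= t <= N%:R ->
  \sum_(i < N) (i.+1%:R <= t)%R%:R <= t <= 1 + \sum_(i < N) (i.+1%:R <= t)%R%:R.
Proof.
move=> /andP[t0 tN].
have full n : n%:R <= t -> \sum_(i < n) (i.+1%:R <= t)%R%:R = n%:R :> R.
  elim: n => [|n IH] nt; first by rewrite big_ord0.
  rewrite big_ord_recr/= nt IH ?natr1//.
  by apply: le_trans nt; rewrite ler_nat.
(* The bound [t <= N] is not inherited by an induction on N, so the upper half carries its own
   premise, one unit weaker. *)
suff [-> ->] : \sum_(i < N) (i.+1%:R <= t)%R%:R <= t /\
    (t <= N.+1%:R -> t <= 1 + \sum_(i < N) (i.+1%:R <= t)%R%:R).
  - by [].
  - by apply: le_trans tN _; rewrite ler_nat.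
  elim: N {tN} => [|N [IH1 IH2]]; first by rewrite big_ord0 addr0; split.
  rewrite big_ord_recr/=; have [Nt|tN] := leP N.+1%:R t.
    rewrite full; last by apply: le_trans Nt; rewrite ler_nat.
    by rewrite natr1; split => //; rewrite nat1r.
  by rewrite addr0; split => // _; apply: IH2; exact: ltW.
Qed.

(** For N > 0 this is the part of Y where f is at least i/N. The weak inequality makes it compact
    when f is continuous on Y, so the content can be evaluated on it. *)
Definition superlevel (T : Type) (R : numDomainType) (Y : set T) (f : T -> R)
    (N i : nat) : set T :=
  [set y | Y y /\ i%:R <= N%:R * f y].

(** * Integrals of continuous functions over the compact set [Y] *)

Section integrals_on_compact.
Context (d : measure_display) (R : realType) (X : measurableMetricType d R).
Variable Y : set X.
Hypotheses (bX : is_borel X) (cY : compact Y).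

Lemma is_borel_open (U : set X) : open U -> measurable U.
Proof. by move=> oU; rewrite bX; exact: sub_sigma_algebra. Qed.

Lemma is_borel_closed (U : set X) : closed U -> measurable U.
Proof.
by move=> cU; rewrite -(setCK U); apply: measurableC; apply: is_borel_open;
  exact: closed_openC.
Qed.

Lemma is_borel_compact (K : set X) : compact K -> measurable K.
Proof.
move=> cK; apply: is_borel_closed; apply: compact_closed => //.
exact: metric_hausdorff.
Qed.

Lemma within_continuous_measurable (f : X -> R) :
  {within Y, continuous f} -> measurable_fun Y f.
Proof.
move=> /continuousP cf; apply: (measurability _ (RGenOpens.measurableE R)).
move=> _ [_ [a [b ->] <-]].
have /open_subspaceP[V oV VY] : open ((f : subspace Y -> R) @^-1` `]a, b[).
  by apply: cf; exact: interval_open.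
by rewrite setIC -VY; apply: measurableI; [exact: is_borel_open|exact: is_borel_compact].
Qed.

Lemma within_continuous_bounded (f : X -> R) :
  {within Y, continuous f} -> exists2 M, 0 < M & forall y, Y y -> `|f y| <= M.
Proof.
move=> cf; have /(@compact_bounded R R)[M0 [_ h0]] := continuous_compact cf cY.
pose M := M0 + 1; have h := h0 M (ltr_pwDr ltr01 (lexx _)).
exists (`|M| + 1); first by rewrite ltr_pwDr.
move=> y Yy; have : `|f y| <= M by apply: h; exists y.
by have := ler_norm M; lra.
Qed.

Lemma within_continuous_integrable (mu : probability X R) (f : X -> R) :
  {within Y, continuous f} -> mu.-integrable Y (EFin \o f).
Proof.
move=> cf; apply: measurable_bounded_integrable.
- exact: is_borel_compact.
- by rewrite (le_lt_trans (probability_le1 _ _)) ?ltry//; exact: is_borel_compact.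
- exact: within_continuous_measurable.
- have [M M0 hM] := within_continuous_bounded cf.
  by exists M; split; [exact: num_real|move=> x Mx y Yy /=; rewrite (le_trans (hM _ Yy))// ltW].
Qed.

(** The shape [a * (f x + b)] is the common normal form for three later reductions: to values in
    [0,1], to nonnegative integrands, and to the opposite function. *)
Lemma within_continuous_affine (f : X -> R) (a b : R) :
  {within Y, continuous f} -> {within Y, continuous (fun x => a * (f x + b))}.
Proof.
move=> cf x; apply: cvgM; first exact: cvg_cst.
by apply: cvgD; [exact: cf|exact: cvg_cst].
Qed.

Lemma Rintegral_affine (mu : probability X R) (f : X -> R) (a b : R) :
  {within Y, continuous f} -> mu Y = 1%E ->
  \int[mu]_(x in Y) (a * (f x + b)) = a * (\int[mu]_(x in Y) f x + b).
Proof.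
move=> cf muY; have mY := is_borel_compact cY.
have cb : {within Y, continuous (fun _ : X => b)} by move=> x; exact: cvg_cst.
have cfb : {within Y, continuous (fun x => f x + b)}.
  by move=> x; apply: cvgD; [exact: cf|exact: cb].
rewrite RintegralZl//; last exact: within_continuous_integrable.
rewrite RintegralD//; try exact: within_continuous_integrable.
rewrite Rintegral_cst//; congr (_ * (_ + _)).
by rewrite [X in fine X](_ : _ = 1%E)// mulr1.
Qed.


Lemma compact_superlevel (f : X -> R) N i :
  {within Y, continuous f} -> compact (superlevel Y f N i).
Proof.
move=> cf.
have ca : {within Y, continuous (fun x => N%:R * (f x + 0))}.
  exact: within_continuous_affine.
have : closed ((fun x => N%:R * (f x + 0) : R) @^-1` [set t : R | i%:R <= t] : set (subspace Y)).
  by move/continuous_closedP : ca; apply; exact: closed_ge.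
move=> /closed_subspaceP[V cV VY].
have -> : superlevel Y f N i = V `&` Y.
  by rewrite VY; apply/seteqP; split => x /=; rewrite addr0 /superlevel /=; tauto.
by rewrite setIC; exact: compact_closedI.
Qed.


(** This integrates [sum_indic_levels] at [N%:R * f x]. The error 1 does not depend on N, so masses
    of compact sets determine the integral up to 1/N. *)
Lemma Rintegral_levels (mu : probability X R) (f : X -> R) N :
  {within Y, continuous f} -> (forall y, Y y -> 0 <= f y <= 1) -> mu Y = 1%E ->
  \sum_(i < N) fine (mu (superlevel Y f N i.+1)) <= N%:R * \int[mu]_(x in Y) f x <=
    1 + \sum_(i < N) fine (mu (superlevel Y f N i.+1)).
Proof.
move=> cf f01 muY; set S := \sum_(i < N) _; have mY : measurable Y by exact: is_borel_compact.
have mL i : measurable (superlevel Y f N i).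
  by apply: is_borel_compact; exact: compact_superlevel.
have finL i : mu (superlevel Y f N i) \is a fin_num by exact: fin_num_measure.
have mf := within_continuous_measurable cf.
have muY' : mu (setT `&` Y) = 1%E by rewrite setTI.
have SE : S%:E = (\int[mu]_(x in Y) (\sum_(i < N) (\1_(superlevel Y f N i.+1) x : R)%:E))%E.
  rewrite ge0_integral_sum//; last by move=> i; apply/measurable_EFinP; exact: measurable_indic.
  rewrite -sumEFin; apply: eq_bigr => i _.
  by rewrite integral_indic// setIidl ?fineK// => x [].
have NE : (N%:R * \int[mu]_(x in Y) f x)%:E = (\int[mu]_(x in Y) (N%:R * f x)%:E)%E.
  rewrite EFinM /Rintegral fineK; last first.
    by apply: integrable_fin_num => //; exact: within_continuous_integrable.
  under [RHS]eq_integral do rewrite EFinM.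
  by rewrite ge0_integralZl//; [exact/measurable_EFinP|move=> x /f01/andP[+ _]; rewrite lee_fin].
have sumE x : Y x -> (\sum_(i < N) (\1_(superlevel Y f N i.+1) x : R)%:E =
    (\sum_(i < N) (i.+1%:R <= N%:R * f x)%R%:R)%:E)%E.
  move=> Yx. rewrite sumEFin; congr _%:E; apply: eq_bigr => i _.
  by rewrite indicE; congr (_%:R); congr nat_of_bool; apply/idP/idP;
    [rewrite inE => -[]|move=> h; rewrite inE].
have f0N x : Y x -> 0 <= N%:R * f x <= N%:R.
  by move=> /f01/andP[f0 f1]; rewrite mulr_ge0//= ler_piMr.
have mS : measurable_fun Y (fun x => \sum_(i < N) (\1_(superlevel Y f N i.+1) x : R)%:E)%E.
  by apply: emeasurable_sum => i; apply/measurable_EFinP; exact: measurable_indic.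
have mNf : measurable_fun Y (fun x => (N%:R * f x)%:E).
  by apply/measurable_EFinP; apply: measurable_funM.
apply/andP; split; rewrite -lee_fin.
- rewrite SE NE; apply: ge0_le_integral => //.
  + by move=> x Yx; rewrite sumE// lee_fin sumr_ge0.
  + by move=> x Yx; rewrite sumE// lee_fin; have /sum_indic_levels/andP[] := f0N _ Yx.
- have -> : (1 + S)%:E = (\int[mu]_(x in Y)
      (1 + \sum_(i < N) (\1_(superlevel Y f N i.+1) x : R)%:E))%E.
    rewrite ge0_integralD//.
    + by rewrite -SE integral_cst// mul1e [X in (X + _)%E](_ : _ = 1%E).
    + by move=> x Yx; rewrite sumE// lee_fin sumr_ge0.
  rewrite NE; apply: ge0_le_integral => //.
  + by move=> x Yx; rewrite lee_fin; have /andP[] := f0N _ Yx.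
  + by apply: emeasurable_funD.
  + by move=> x Yx; rewrite sumE// lee_fin; have /sum_indic_levels/andP[] := f0N _ Yx.
Qed.

Lemma Rintegral_bound (mu : probability X R) (f : X -> R) (M : R) :
  {within Y, continuous f} -> mu Y = 1%E -> (forall y, Y y -> `|f y| <= M) ->
  `|\int[mu]_(x in Y) f x| <= M.
Proof.
move=> cf muY fM; have mY := is_borel_compact cY.
have ccst (a : R) : {within Y, continuous (fun _ : X => a)} by move=> x; exact: cvg_cst.
have Icst (a : R) : \int[mu]_(x in Y) a = a.
  by rewrite Rintegral_cst// [X in fine X](_ : _ = 1%E)// mulr1.
rewrite ler_norml -{1}(Icst (- M)) -{2}(Icst M).
apply/andP; split; apply: le_Rintegral => //;
  try exact: within_continuous_integrable; by move=> x /fM; rewrite ler_norml => /andP[].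
Qed.

End integrals_on_compact.

(** * Ultrafilter limits of probability measures on [Y] *)

Section compactness.
Context (d : measure_display) (R : realType) (X : measurableMetricType d R).
Variable Y : set X.
Hypotheses (bX : is_borel X) (cY : compact Y).

Lemma prob_on_valP (mu : prob_on Y) : prob_on_val mu Y = 1%E.
Proof. exact: (set_valP mu). Qed.

Lemma compact_prob_on : compact [set: prob_on Y].
Proof.
rewrite compact_ultra => F FU _; have PF := @ultra_proper _ _ FU.
pose m (A : set X) (mu : prob_on Y) : R := fine (prob_on_val mu A).
have m01 A mu : measurable A -> 0 <= m A mu <= 1.
  move=> mA; have p1 := probability_le1 (prob_on_val mu) mA.
  have pfin : prob_on_val mu A \is a fin_num by exact: fin_num_measure.
  by rewrite fine_ge0//= -lee_fin fineK.
(* The limiting mass is chosen for all sets at once; it is a dummy value 0 on nonmeasurable ones. *)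
have /choice[nu hnu] (A : set X) : exists l : R, measurable A -> m A mu @[mu --> F] --> l.
  have [mA|] := pselect (measurable A); last by exists 0.
  have [|l hl] := @ultra_bounded_cvg R _ F (m A) 0 1 FU; last by exists l.
  by move=> mu; exact: m01.
have mK (K : set X) : compact K -> measurable K by exact: is_borel_compact.
have nuY : nu Y = 1.
  apply: (@cvg_unique _ _ (m Y mu @[mu --> F])) => //; first exact: hnu (mK _ cY).
  have -> : m Y = fun=> 1 by apply/funext => mu; rewrite /m prob_on_valP.
  exact: cvg_cst.
have mD (K L : set X) mu : compact K -> compact L -> K `&` L = set0 ->
    m (K `|` L) mu = m K mu + m L mu.
  move=> cK cL KL; rewrite /m measureU//; try exact: mK.
  by rewrite fineD//; apply: fin_num_measure; exact: mK.
have mU (K L : set X) mu : compact K -> compact L -> m (K `|` L) mu <= m K mu + m L mu.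
  move=> cK cL; have fm (A : set X) : compact A -> prob_on_val mu A \is a fin_num.
    by move=> cA; apply: fin_num_measure; exact: mK.
  rewrite -lee_fin EFinD /m !fineK; try exact: fm.
    by apply: measureU2; exact: mK.
  by apply: fm; exact: compactU.
have cm (K : set X) : compact K -> m K mu @[mu --> F] --> nu K by move=> /mK /hnu.
have [p hp] : exists p : probability X R, forall K, compact K -> ((nu K)%:E <= p K)%E.
  apply: (@content_probability d R X nu _ _ _ _ Y) => //.
  - move=> K cK; apply: (ler_cvg_to (cvg_cst 0) (cm _ cK)).
    by apply: nearW => mu; have /andP[] := m01 _ mu (mK _ cK).
  - move=> K cK; apply: (ler_cvg_to (cm _ cK) (cvg_cst (1 : R))).
    by apply: nearW => mu; have /andP[] := m01 _ mu (mK _ cK).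
  - move=> K L cK cL.
    apply: (ler_cvg_to (cm _ (compactU cK cL)) (cvgD (cm _ cK) (cm _ cL))).
    by apply: nearW => mu; exact: mU.
  - move=> K L cK cL KL.
    apply: (ler_cvg_to (cvgD (cm _ cK) (cm _ cL)) (cm _ (compactU cK cL))).
    by apply: nearW => mu; rewrite mD.
have pY : p Y = 1%E.
  have := hp _ cY; rewrite nuY => pY1.
  apply/eqP; rewrite eq_le; apply/andP; split=> //.
  by apply: probability_le1; exact: mK.
pose q : prob_on Y := SigSub (mem_set (pY : [set mu : pprobability X R | mu Y = 1%E] p)).
exists q; split => //.
(* Half of the portmanteau theorem: the content of each compact superlevel set is at most its
   p-mass, so summing levels gives [N l <= 1 + N I] for every N, with I the integral of f against
   p. *)
have le01 (f : X -> R) l : {within Y, continuous f} ->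
    (forall y, Y y -> 0 <= f y <= 1) ->
    \int[prob_on_val mu]_(x in Y) f x @[mu --> F] --> l ->
    l <= \int[p]_(x in Y) f x.
  move=> cf f01 fl; rewrite leNgt; apply/negP => lt.
  have lin N : N%:R * l <= 1 + N%:R * \int[p]_(x in Y) f x.
    have cL i : compact (superlevel Y f N i) by exact: compact_superlevel.
    have /andP[pS _] := Rintegral_levels bX cY N cf f01 pY.
    have S1 : N%:R * l <= 1 + \sum_(i < N) nu (superlevel Y f N i.+1).
      have cS n : (\sum_(i < n) m (superlevel Y f N i.+1) mu) @[mu --> F] -->
          \sum_(i < n) nu (superlevel Y f N i.+1).
        elim: n => [|n IH].
          by rewrite big_ord0; under eq_fun do rewrite big_ord0; exact: cvg_cst.
        rewrite big_ord_recr; under eq_fun do rewrite big_ord_recr/=.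
        by apply: cvgD IH _; exact: cm.
      apply: (ler_cvg_to (cvgM (cvg_cst (N%:R : R)) fl) (cvgD (cvg_cst (1 : R)) (cS N))).
      apply: nearW => mu.
      by have /andP[_] := Rintegral_levels bX cY N cf f01 (prob_on_valP mu).
    apply: le_trans S1 _; rewrite lerD2l; apply: le_trans pS.
    apply: ler_sum => i _; rewrite -lee_fin fineK; first exact: hp.
    by apply: fin_num_measure; exact: mK.
  set I := (\int[p]_(x in Y) f x) in lt lin.
  have lI : 0 < l - I by rewrite subr_gt0.
  (* This N exceeds 1/(l - I), so [N (l - I) > 1] contradicts the bound. *)
  have := lin (Num.truncn (l - I)^-1).+1.
  have := truncnS_gt (l - I)^-1.
  set N := _%:R; rewrite -(ltr_pM2r lI) mulVf ?gt_eqF// mulrBr => ? ?; lra.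
have le (f : X -> R) l : {within Y, continuous f} ->
    \int[prob_on_val mu]_(x in Y) f x @[mu --> F] --> l ->
    l <= \int[p]_(x in Y) f x.
  move=> cf fl; have [M M0 fM] := within_continuous_bounded cY cf.
  (* Since |f| is at most M on Y, [(f + M) / (2 M)] takes values in [0,1] there. *)
  pose a := (2 * M)^-1; have a0 : 0 < a by rewrite invr_gt0 mulr_gt0.
  have := @le01 (fun x => a * (f x + M)) (a * (l + M)).
  rewrite Rintegral_affine// ler_pM2l// lerD2r; apply.
  - exact: within_continuous_affine.
  - move=> y /fM; rewrite ler_norml => /andP[f1 f2].
    apply/andP; split; first by apply: mulr_ge0; [exact: ltW|lra].
    by rewrite mulrC ler_pdivrMr ?mulr_gt0//; lra.
  - under eq_fun do rewrite Rintegral_affine ?prob_on_valP//.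
    by apply: cvgM; [exact: cvg_cst|apply: cvgD => //; exact: cvg_cst].
apply/cvg_test_integralsP => -[f cf]; rewrite /test_integrals/=.
have [M M0 fM] := within_continuous_bounded cY cf.
have [|l fl] := @ultra_bounded_cvg R _ F
    (fun mu : prob_on Y => \int[prob_on_val mu]_(x in Y) f x) (- M) M FU.
  move=> mu; have muY := prob_on_valP mu.
  have := Rintegral_bound bX cY cf muY fM.
  by rewrite ler_norml.
suff -> : \int[p]_(x in Y) f x = l by [].
apply/eqP; rewrite eq_le le// andbT.
(* The one-sided bound applied to -f yields the reverse inequality. *)
have := @le (fun x => -1 * (f x + 0)) (-1 * (l + 0)).
rewrite Rintegral_affine// !mulN1r lerN2 !addr0; apply.
- exact: within_continuous_affine.
- under eq_fun do rewrite Rintegral_affine ?prob_on_valP// addr0 mulN1r.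
  exact: cvgN.
Qed.
End compactness.

(** * Minimax *)

Section minimax.
Context (R : realType) (T : topologicalType) (I : choiceType).
Variables (C : set T) (D : set I) (f : I -> T -> R) (a : R).
Hypothesis cC : compact C.
Hypothesis C0 : C !=set0.
Hypothesis cf : forall i, D i -> continuous (f i).
Hypothesis affine_f : forall mu nu t, C mu -> C nu -> 0 <= t <= 1 ->
  exists2 rho, C rho & forall i, D i -> f i rho = (1 - t) * f i mu + t * f i nu.
Hypothesis concave_f : forall (s : seq I) (l : I -> R),
  {in s, forall i, D i} -> (forall i, 0 <= l i) -> \sum_(i <- s) l i = 1 ->
  exists2 v, D v & forall mu, C mu -> \sum_(i <- s) l i * f i mu <= f v mu.
Hypothesis fa : forall i, D i -> exists2 mu, C mu & f i mu < a.

(* The weights are read off the first-order condition at a minimiser of the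
   squared distance from (f i mu)_i to the orthant of the points <= a. *)
Lemma finite_minimax (s : seq I) : {in s, forall i, D i} ->
  exists2 mu, C mu & {in s, forall i, f i mu <= a}.
Proof.
move=> sD.
pose pos (x : R) := Num.max 0 x.
pose h mu := \sum_(i <- s) pos (f i mu - a) ^+ 2.
have ch : continuous h.
  have pc : continuous pos.
    by move=> x; apply: (@continuous_max R R) => //; exact: cvg_cst.
  rewrite /h {h}; elim: s sD => [|i s' IH] sD mu.
    by under eq_fun do rewrite big_nil; exact: cvg_cst.
  under eq_fun do rewrite big_cons.
  apply: cvgD; last by apply: IH => j js; apply: sD; rewrite inE js orbT.
  have Di : D i by apply: sD; rewrite mem_head.
  have ci : {for mu, continuous (fun nu => pos (f i nu - a))}.
    apply: (@continuous_comp _ _ _ (fun nu => f i nu - a) pos); last exact: pc.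
    by apply: cvgB; [exact: cf|exact: cvg_cst].
  by apply: cvgM.
have [mu0 + hmin] := compact_EVT_min C0 cC (continuous_subspaceT ch).
rewrite inE => Cmu0.
pose r i := pos (f i mu0 - a).
have r0 i : 0 <= r i by rewrite /r /pos le_max lexx.
have [rs0|] := pselect (forall i, i \in s -> r i = 0).
  exists mu0 => // i si; have := rs0 i si.
  by rewrite /r /pos => rE; rewrite -subr_le0 -rE le_max lexx orbT.
move=> /existsNP[i0 /not_implyP[si0 /eqP ri0]].
have S2 : 0 < \sum_(i <- s) r i ^+ 2.
  rewrite lt_neqAle sumr_ge0 ?andbT; last by move=> i _; exact: sqr_ge0.
  rewrite eq_sym psumr_eq0; last by move=> i _; exact: sqr_ge0.
  by apply/negP => /allP/(_ i0 si0); rewrite /= sqrf_eq0 (negbTE ri0).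
have S1 : 0 < \sum_(i <- s) r i.
  rewrite lt_neqAle sumr_ge0// andbT eq_sym psumr_eq0//.
  by apply/negP => /allP/(_ i0 si0); rewrite /= (negbTE ri0).
have key nu : C nu -> \sum_(i <- s) r i ^+ 2 <= \sum_(i <- s) r i * (f i nu - a).
  move=> Cnu; pose y i := f i nu - a.
  pose A := \sum_(i <- s) r i * (y i - r i).
  pose B := \sum_(i <- s) (y i - r i) ^+ 2.
  have B0 : 0 <= B by apply: sumr_ge0 => i _; exact: sqr_ge0.
  have ineq t : 0 <= t <= 1 -> 0 <= 2 * t * A + t ^+ 2 * B.
    move=> t01; have [rho Crho frho] := affine_f Cmu0 Cnu t01.
    have h1 : h mu0 <= h rho by apply: hmin; rewrite inE.
    move/andP: t01 => [t0 t1].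
    (* A quadratic majorant of h along the segment from mu0, exact at t = 0; it replaces
       differentiating the squared positive part. *)
    have h2 : h rho <= \sum_(i <- s) ((1 - t) * r i + t * y i) ^+ 2.
      rewrite /h big_seq [leRHS]big_seq; apply: ler_sum => i si.
      rewrite frho; last exact: sD.
      have -> : (1 - t) * f i mu0 + t * f i nu - a =
          (1 - t) * (f i mu0 - a) + t * y i by rewrite /y; ring.
      rewrite /pos; have [le0|_] := leP 0 ((1 - t) * (f i mu0 - a) + t * y i); last first.
        by rewrite expr0n sqr_ge0.
      have le1 : (1 - t) * (f i mu0 - a) + t * y i <= (1 - t) * r i + t * y i.
        rewrite lerD2r ler_wpM2l ?subr_ge0//.
        by rewrite /r /pos le_max lexx orbT.
      by rewrite ler_sqr ?nnegrE// (le_trans le0).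
    have h3 : \sum_(i <- s) ((1 - t) * r i + t * y i) ^+ 2 =
        h mu0 + 2 * t * A + t ^+ 2 * B.
      rewrite /h /A /B !mulr_sumr -!big_split/=; apply: eq_bigr => i _.
      by rewrite -/(r i); ring.
    by move: (le_trans h1 h2); rewrite h3; lra.
  have A0 : 0 <= A.
    rewrite leNgt; apply/negP => An.
    have BA : 0 < B - A by lra.
    (* The minimiser -A/B of the quadratic could exceed 1, and B may vanish. Enlarging the
       denominator keeps t in (0,1] and still gives [t B <= - A], hence [2 A + t B <= A < 0]. *)
    pose t := - A / (B - A).
    have t0 : 0 < t by rewrite divr_gt0// oppr_gt0.
    have t1 : t <= 1 by rewrite ler_pdivrMr// mul1r; lra.
    have tB : t * B <= - A.
      by rewrite /t mulrAC ler_pdivrMr// ler_pM2l ?oppr_gt0//; lra.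
    have := ineq t; rewrite ltW//= t1 => /(_ isT).
    rewrite (_ : _ + _ = t * (2 * A + t * B)); last by ring.
    by rewrite pmulr_rge0//; lra.
  rewrite -subr_ge0 -sumrB; apply: le_trans A0 _.
  by rewrite le_eqVlt; apply/orP; left; apply/eqP; apply: eq_bigr => i _; rewrite /y; ring.
have [|||v Dv hv] := @concave_f s (fun i => r i / \sum_(i <- s) r i).
- by [].
- by move=> i; rewrite divr_ge0// ltW.
- by rewrite -mulr_suml divff// gt_eqF.
(* With S the sum of the r i, [key] gives [S a] strictly below the sum of the [r i * f i nu]. That
   sum is at most [S * f v nu] by concavity, and [f v nu < a] by the choice of nu: a
   contradiction. *)
have [nu Cnu] := fa Dv; have := hv nu Cnu; have := key nu Cnu.
set S := \sum_(i <- s) r i in S1 *.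
have -> : \sum_(i <- s) r i * (f i nu - a) = \sum_(i <- s) r i * f i nu - S * a.
  by rewrite /S mulr_suml -sumrB; apply: eq_bigr => i _; ring.
have -> : \sum_(i <- s) r i / S * f i nu = S^-1 * \sum_(i <- s) r i * f i nu.
  by rewrite mulr_sumr; apply: eq_bigr => i _; ring.
rewrite ler_pdivrMl// => h1 h2 h3.
have : S * f v nu < S * a by rewrite ltr_pM2l.
lra.
Qed.

(** By [finite_minimax] the sets of mu in C with [f i mu <= a] have the finite intersection
    property. They generate a filter on the compact C, and a cluster point lies in each of them
    because the sublevel sets are closed. *)
Lemma minimax : exists2 mu, C mu & forall i, D i -> f i mu <= a.
Proof.
pose g i := C `&` (f i @^-1` [set x | x <= a]).
have gI : finI D g.
  move=> D' D'D; have [|mu Cmu fmu] := @finite_minimax (finmap.enum_fset D').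
    by move=> i iD'; have := D'D i iD'; rewrite inE.
  by exists mu => i /= iD'; split => //; exact: fmu.
(* An index is needed to place C in the filter; for empty D any point of C will do. *)
have [[i0 Di0]|D0] := pselect (D !=set0); last first.
  by have [mu Cmu] := C0; exists mu => // i Di; exfalso; apply: D0; exists i.
have PF := finI_filter gI.
have [|p [Cp clp]] := cC PF.
  by exists (g i0); [exact: finI_from1|move=> ? []].
exists p => // i Di.
have cl : closed (f i @^-1` [set x | x <= a]).
  by apply: (continuous_closedP _).1; [exact: cf|exact: closed_le].
apply: cl => B; apply: clp; exists (g i); first exact: finI_from1.
by move=> ? [].
Qed.

End minimax.

(** Jensen's inequality, from the tangent line at the mean m: each [expR (x i)] is at least
    [expR m * (1 + (x i - m))], and the linear terms average to zero. *)
Lemma expR_convex_sum (R : realType) (I : Type) (s : seq I) (l x : I -> R) :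
  (forall i, 0 <= l i) -> \sum_(i <- s) l i = 1 ->
  expR (\sum_(i <- s) l i * x i) <= \sum_(i <- s) l i * expR (x i).
Proof.
move=> l0 l1; set m := \sum_(i <- s) l i * x i.
have -> : expR m = \sum_(i <- s) l i * (expR m * (1 + (x i - m))).
  transitivity (expR m * \sum_(i <- s) (l i + (l i * x i - l i * m))).
    by rewrite big_split/= sumrB -mulr_suml l1 mul1r subrr addr0 mulr1.
  by rewrite mulr_sumr; apply: eq_bigr => i _; ring.
apply: ler_sum => i _; apply: ler_wpM2l => //.
rewrite -[in leRHS](subrK m (x i)) expRD mulrC ler_wpM2r ?expR_ge0//.
exact: expR_ge1Dx.
Qed.

(** * The Markov property for integrals *)

Section nonnegative_induction.
Import HBNNSimple.
Local Open Scope ereal_scope.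
Context (d : measure_display) (T : measurableType d) (R : realType).
Variable Q : (T -> \bar R) -> Prop.
Hypothesis Q_indic : forall A, measurable A -> Q (fun x => (\1_A x : R)%:E).
Hypothesis Q_scale : forall (c : R) f, (0 <= c)%R -> measurable_fun setT f ->
  (forall x, 0 <= f x) -> Q f -> Q (fun x => c%:E * f x).
Hypothesis Q_add : forall f g, measurable_fun setT f -> (forall x, 0 <= f x) ->
  measurable_fun setT g -> (forall x, 0 <= g x) ->
  Q f -> Q g -> Q (fun x => f x + g x).
Hypothesis Q_lim : forall f : nat -> T -> \bar R,
  (forall n, measurable_fun setT (f n)) -> (forall n x, 0 <= f n x) ->
  (forall x, {homo f ^~ x : n m / (n <= m)%N >-> n <= m}) ->
  (forall n, Q (f n)) -> Q (fun x => limn (f ^~ x)).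

(** The passage from indicators to simple functions to increasing limits, for an abstract predicate
    because it is applied twice: to functions of the next state, then to weights depending on the
    past. *)
Lemma ge0_measurable_ind f :
  measurable_fun setT f -> (forall x, 0 <= f x) -> Q f.
Proof.
move=> mf f0; pose g := nnsfun_approx measurableT mf.
have -> : f = (fun x => limn (fun n => (g n x)%:E)).
  apply/funext => x; apply/esym/cvg_lim => //.
  exact: (@cvg_nnsfun_approx _ _ _ _ measurableT _ mf).
apply: (Q_lim (f := fun n x => (g n x)%:E)).
- by move=> n; apply/measurable_EFinP.
- by move=> n x; rewrite lee_fin.
- by move=> x n m nm; rewrite lee_fin; apply/lefP; exact: nd_nnsfun_approx.
move=> n; pose s := finmap.enum_fset (fset_set (range (g n))).
pose h (y : R) x : \bar R := y%:E * (\1_(g n @^-1` [set y]) x : R)%:E.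
have mh y : measurable_fun setT (h y).
  by apply: emeasurable_funM => //; apply/measurable_EFinP; exact: measurable_indic.
have -> : (fun x => (g n x)%:E) = (fun x => \sum_(y <- s) h y x).
  apply/funext => x; rewrite /h fimfunE fsbig_finite//= -sumEFin.
  by apply: eq_bigr => y _; rewrite EFinM.
have : {in s, forall y, 0 <= y}%R.
  by move=> y; rewrite /s in_fset_set// inE => -[x _ <-].
elim: s => [|y s IH] s0.
  have -> : (fun x => \sum_(y <- [::]) h y x) = (fun x => (\1_(@set0 T) x : R)%:E).
    by apply/funext => x; rewrite big_nil indic0.
  exact: Q_indic.
have y0 : (0 <= y)%R by apply: s0; rewrite mem_head.
have {}s0 : {in s, forall y, 0 <= y}%R by move=> z zs; apply: s0; rewrite inE zs orbT.
have -> : (fun x => \sum_(z <- y :: s) h z x) = (fun x => h y x + \sum_(z <- s) h z x).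
  by apply/funext => x; rewrite big_cons.
have h0 z x : (0 <= z)%R -> 0 <= h z x.
  by move=> z0; rewrite mule_ge0// lee_fin.
apply: Q_add => //.
- by move=> x; exact: h0.
- exact: emeasurable_sum.
- by move=> x; rewrite big_seq sume_ge0// => z /s0; exact: h0.
- apply: Q_scale => //; first by apply/measurable_EFinP; exact: measurable_indic.
  by apply: Q_indic; rewrite -[X in measurable X]setTI; exact: measurable_funP.
- exact: IH.
Qed.

End nonnegative_induction.

Section markov_property.
Context (d d' : measure_display) (R : realType) (X : measurableMetricType d R)
  (Omega : measurableType d').
Variables (K : R.-pker X ~> X) (P : X -> probability Omega R)
  (Z : nat -> {mfun Omega >-> X}).
Hypothesis mZ : is_markov_chain K P Z.

(** The carrier is Omega with sigma(Z_0, ..., Z_t) as its measurable sets. Dependence on the past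
    becomes ordinary measurability, to which [ge0_measurable_ind] applies. *)
Definition pastType (t : nat) : Type := g_sigma_algebraType
  (\bigcup_(k in `I_t.+1) preimage_set_system setT (Z k) measurable).

HB.instance Definition _ t := Measurable.on (pastType t).

Lemma past_measurable t (A : set Omega) : past Z t A -> measurable A.
Proof.
move: A; apply: smallest_sub; first exact: sigma_algebra_measurable.
move=> A [k _ [B mB <-]]; exact: measurable_funP.
Qed.

Lemma measurable_pastType t d1 (T1 : measurableType d1) (f : pastType t -> T1) :
  measurable_fun setT f -> measurable_fun setT (f : Omega -> T1).
Proof. by move=> mf _ B mB; apply: (@past_measurable t); exact: (mf measurableT B mB). Qed.

Lemma measurable_fun_past t k : (k <= t)%N ->
  measurable_fun setT (Z k : pastType t -> X).
Proof.
move=> kt _ B mB; apply: sub_sigma_algebra; exists k; first by rewrite /= ltnS.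
by exists B.
Qed.

Local Open Scope ereal_scope.

(** For an indicator h this is the defining property of the chain. *)
Lemma markov_integral_past x t F (h : X -> \bar R) : past Z t F ->
  measurable_fun setT h -> (forall y, 0 <= h y) ->
  \int[P x]_(w in F) h (Z t.+1 w) = \int[P x]_(w in F) \int[K (Z t w)]_y h y.
Proof.
move=> pF; have mF := past_measurable pF.
have mcomp k (f : X -> \bar R) : measurable_fun setT f ->
    measurable_fun F (fun w => f (Z k w)).
  move=> mf; apply: measurable_funS measurableT _ _ => //.
  exact: measurableT_comp.
have mK (f : X -> \bar R) : measurable_fun setT f -> (forall y, 0 <= f y) ->
    measurable_fun setT (fun x => \int[K x]_y f y).
  by move=> mf f0; apply: measurable_fun_integral_kernel => // U mU; exact: measurable_kernel.
apply: (@ge0_measurable_ind _ _ _ (fun h =>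
  \int[P x]_(w in F) h (Z t.+1 w) = \int[P x]_(w in F) \int[K (Z t w)]_y h y)).
- move=> A mA; have [_ mar] := mZ.
  under [RHS]eq_integral do rewrite integral_indic// setIT.
  have mA' : measurable (Z t.+1 @^-1` A).
    by rewrite -[X in measurable X]setTI; exact: measurable_funP.
  by rewrite -mar// setIC -integral_indic.
- move=> c f c0 mf f0 IH.
  rewrite ge0_integralZl//; last exact: mcomp.
  under [RHS]eq_integral do rewrite ge0_integralZl//.
  rewrite ge0_integralZl//; [by rewrite IH|exact: (mcomp t _ (mK f mf f0))|].
  by move=> w _; exact: integral_ge0.
- move=> f g mf f0 mg g0 IHf IHg.
  rewrite ge0_integralD//; [|exact: mcomp..].
  under [RHS]eq_integral do rewrite ge0_integralD//.
  rewrite ge0_integralD//; [by rewrite IHf IHg| |exact: (mcomp t _ (mK f mf f0))| |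
    exact: (mcomp t _ (mK g mg g0))].
    by move=> w _; exact: integral_ge0.
  by move=> w _; exact: integral_ge0.
- move=> f mf f0 nf IH.
  rewrite (@monotone_convergence _ _ _ (P x) F mF (fun n w => f n (Z t.+1 w)))//;
    last by move=> n; exact: mcomp.
  under [RHS]eq_integral do rewrite monotone_convergence//.
  rewrite (@monotone_convergence _ _ _ (P x) F mF (fun n w => \int[K (Z t w)]_y f n y))//.
  + by congr (limn _); apply/funext => n; exact: IH.
  + by move=> n; exact: (mcomp t _ (mK (f n) (mf n) (f0 n))).
  + by move=> n w _; exact: integral_ge0.
  + by move=> w _ n m nm; apply: ge0_le_integral => // y _; exact: nf.
Qed.

(** The induction is now on the weight G, whose indicator case is [markov_integral_past]. The bound
    M makes both factors multiplying G finite, so products commute with increasing limits of G. *)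
Lemma markov_integral x t (G : pastType t -> \bar R) (h : X -> \bar R) (M : R) :
  measurable_fun setT G -> (forall w, 0 <= G w) ->
  measurable_fun setT h -> (forall y, 0 <= h y <= M%:E) ->
  \int[P x]_w (G w * h (Z t.+1 w)) = \int[P x]_w (G w * \int[K (Z t w)]_y h y).
Proof.
move=> mG G0 mh h0M.
have h0 y : 0 <= h y by have /andP[] := h0M y.
have hfin y : h y \is a fin_num.
  by have /andP[_ hM] := h0M y; rewrite ge0_fin_numE// (le_lt_trans hM)// ltry.
have mhZ : measurable_fun setT (fun w => h (Z t.+1 w)) by exact: measurableT_comp.
have mKZ : measurable_fun setT (fun w => \int[K (Z t w)]_y h y).
  apply: (measurableT_comp (f := fun x => \int[K x]_y h y)) => //.
  by apply: measurable_fun_integral_kernel => // U mU; exact: measurable_kernel.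
have K0 w : 0 <= \int[K (Z t w)]_y h y by exact: integral_ge0.
have Kfin w : \int[K (Z t w)]_y h y \is a fin_num.
  rewrite ge0_fin_numE//; apply: (@le_lt_trans _ _ (\int[K (Z t w)]_y M%:E)).
    by apply: ge0_le_integral => // y _; have /andP[] := h0M y.
  by rewrite integral_cst// prob_kernel mule1 ltry.
apply: (@ge0_measurable_ind _ (pastType t) _ (fun G =>
  \int[P x]_w (G w * h (Z t.+1 w)) = \int[P x]_w (G w * \int[K (Z t w)]_y h y))) => //.
- move=> A mA.
  have := markov_integral_past x mA mh h0.
  rewrite [in LHS]integral_mkcond [in X in _ = X -> _]integral_mkcond.
  have E (g : Omega -> \bar R) : g \_ A = (fun w => (\1_A w : R)%:E * g w).
    by apply/funext => w; rewrite patchE indicE; case: ifP; rewrite (mul1e,mul0e).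
  by rewrite !E.
- move=> c f c0 /measurable_pastType mf f0 IH.
  under eq_integral do rewrite -muleA.
  under [RHS]eq_integral do rewrite -muleA.
  rewrite !ge0_integralZl ?IH//.
  + exact: emeasurable_funM.
  + by move=> w _; exact: mule_ge0.
  + exact: emeasurable_funM.
  + by move=> w _; exact: mule_ge0.
- move=> f g /measurable_pastType mf f0 /measurable_pastType mg g0 IHf IHg.
  under eq_integral do rewrite ge0_muleDl//.
  under [RHS]eq_integral do rewrite ge0_muleDl//.
  rewrite !ge0_integralD ?IHf ?IHg//; try exact: emeasurable_funM;
    by move=> w _; exact: mule_ge0.
- move=> f mf f0 nf IH.
  have E (g : \bar R) w : g \is a fin_num ->
      limn (f ^~ w) * g = limn (fun n => f n w * g).
    move=> gfin; apply/esym/cvg_lim => //; apply: cvgeZr => //.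
    exact: ereal_nondecreasing_is_cvgn (nf w).
  have -> : (fun w => limn (f ^~ w) * h (Z t.+1 w)) =
      (fun w => limn (fun n => f n w * h (Z t.+1 w))).
    by apply/funext => w; rewrite E.
  have -> : (fun w => limn (f ^~ w) * \int[K (Z t w)]_y h y) =
      (fun w => limn (fun n => f n w * \int[K (Z t w)]_y h y)).
    by apply/funext => w; rewrite E.
  rewrite !monotone_convergence//.
  + by congr (limn _); apply/funext => n; exact: IH.
  + by move=> n; apply: emeasurable_funM => //; exact: (measurable_pastType (mf n)).
  + by move=> n w _; exact: mule_ge0.
  + by move=> w _ n m nm; apply: lee_wpmul2r => //; exact: nf.
  + by move=> n; apply: emeasurable_funM => //; exact: (measurable_pastType (mf n)).
  + by move=> n w _; exact: mule_ge0.
  + by move=> w _ n m nm; apply: lee_wpmul2r => //; exact: nf.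
Qed.

End markov_property.

(** * Visit counts and occupation measures along a path *)

Section visits.
Context (T : Type) (Y : set T).
Implicit Type z : nat -> T.

Definition visits z (t : nat) : nat := \sum_(k < t) (z k \in Y).

Definition hit (n : nat) z (t : nat) : Prop := z t \in Y /\ (visits z t).+1 = n.

Lemma visits0 z : visits z 0 = 0%N.
Proof. by rewrite /visits big_ord0. Qed.

Lemma visitsS z t : visits z t.+1 = (visits z t + (z t \in Y))%N.
Proof. by rewrite /visits big_ord_recr. Qed.

Lemma leq_visits z : {homo visits z : s t / (s <= t)%N}.
Proof.
by apply: homo_leq => //; [exact: leq_trans|move=> t; rewrite visitsS leq_addr].
Qed.

Lemma hit_visits n z t : hit n z t -> visits z t.+1 = n.
Proof. by move=> [zY <-]; rewrite visitsS zY addn1. Qed.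

(** The count starts at 0 and grows by at most one at each step, so it skips no value. *)
Lemma hit_exists n z t : (0 < n)%N -> (n <= visits z t)%N -> exists s, hit n z s.
Proof.
move=> n0; elim: t => [|t IH]; first by rewrite visits0 leqNgt n0.
have [/IH//|lt] := leqP n (visits z t).
rewrite visitsS; case: (boolP (z t \in Y)) => zY h; last first.
  by move: h; rewrite addn0 leqNgt lt.
by exists t; split => //; apply/eqP; rewrite eqn_leq lt/= -addn1.
Qed.

End visits.

Section occupation_at_hit.
Context (d d' : measure_display) (R : realType) (X : measurableMetricType d R)
  (Omega : measurableType d').
Variables (Z : nat -> {mfun Omega >-> X}) (Y : set X).

Lemma local_timeE t w : local_time Z t Y w = (visits Y (Z ^~ w) t)%:R.
Proof.
rewrite /local_time /visits natr_sum big_mkord; apply: eq_bigr => k _.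
by rewrite indicE.
Qed.

(** The local time first equals n at [t.+1]: the visit at t is counted there, and by monotonicity no
    earlier time counts more than n - 1 visits. *)
Lemma lt_tau_hit n t w k : hit Y n (Z ^~ w) t ->
  (k%:R%:E < tau Z Y n w)%E = (k < t.+1)%N.
Proof.
move=> ht; apply/idP/idP => [kt|kt].
  rewrite -(ltr_nat R) -lte_fin; apply: lt_le_trans kt _.
  apply: ereal_inf_lbound; exists t.+1 => //; split => //.
  by rewrite local_timeE (hit_visits ht).
apply: (@lt_le_trans _ _ t.+1%:R%:E); first by rewrite lte_fin ltr_nat.
apply: le_ereal_inf_tmp => _ [s [s1 st] <-]; rewrite lee_fin ler_nat.
rewrite leqNgt; apply/negP; rewrite ltnS => /(leq_visits Y (Z ^~ w)).
move: st; rewrite local_timeE => /eqP; rewrite eqr_nat => /eqP ->.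
by case: ht => _ <-; rewrite ltnn.
Qed.

Lemma trace_occupation_hit n t w A : hit Y n (Z ^~ w) t ->
  trace_occupation Z Y n A w = (n%:R^-1 * \sum_(k < t.+1) \1_A (Z k w))%:E.
Proof.
move=> ht; rewrite /trace_occupation EFinM; congr (_ * _)%E.
rewrite (eq_eseriesl (Q := fun k => (k < t.+1)%N)); last by move=> k; exact: lt_tau_hit.
rewrite (nneseries_split_cond 0 t.+1)/=; last by move=> k *; rewrite lee_fin indicE ler0n.
rewrite add0n [X in (_ + X)%E]eseries0 ?adde0; last first.
  by move=> k tk kt; move: tk; rewrite leqNgt kt.
rewrite -sumEFin big_mkord big_mkcond; apply: eq_bigr => k _.
by rewrite ltn_ord.
Qed.

(** Without an n-th visit every partial count is at most n - 1, so the trace occupation gives Y mass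
    at most (n - 1)/n, whereas a member of [prob_on Y] gives it mass one. *)
Lemma occupation_in_hit n (C : set (prob_on Y)) w : measurable Y -> (0 < n)%N ->
  occupation_in Z n C w -> exists t, hit Y n (Z ^~ w) t.
Proof.
move=> mY n0 [mu Cmu muE]; apply: contrapT => /forallNP nh.
have lt t : (visits Y (Z ^~ w) t < n)%N.
  rewrite ltnNge; apply/negP => /(hit_exists n0)[s hs]; exact: (nh s).
have := muE Y mY (@subset_refl _ _); rewrite (set_valP mu : _ = 1%E).
rewrite /trace_occupation; set S := (\sum_(0 <= k <oo | _) _)%E => SE.
have : (S <= (n.-1)%:R%:E)%E.
  apply: lime_le.
    by apply: is_cvg_nneseries => k _ _; rewrite lee_fin indicE ler0n.
  apply: nearW => t; rewrite big_mkcond/=.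
  apply: (@le_trans _ _ (\sum_(0 <= k < t) (\1_Y (Z k w))%:E)%E).
    by apply: lee_sum => k _; case: ifP => // _; rewrite lee_fin indicE ler0n.
  rewrite sumEFin big_mkord lee_fin.
  have -> : \sum_(k < t) \1_Y (Z k w) = (visits Y (Z ^~ w) t)%:R :> R.
    by rewrite -local_timeE /local_time big_mkord.
  by rewrite ler_nat -ltnS prednK.
move=> Sle; have : (n%:R^-1%:E * S <= n%:R^-1%:E * (n.-1)%:R%:E)%E.
  by apply: lee_wpmul2l => //; rewrite lee_fin invr_ge0.
rewrite SE -EFinM lee_fin ler_pdivlMl ?ltr0n// mulr1 ler_nat.
by rewrite leqNgt prednK // leqnn.
Qed.

End occupation_at_hit.

Section empirical_measure.
Context (d : measure_display) (R : realType) (X : measurableMetricType d R).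
Variables (Y : set X) (z : nat -> X) (n t : nat).
Hypotheses (bX : is_borel X) (cY : compact Y) (n0 : (0 < n)%N).
Hypothesis zt : visits Y z t.+1 = n.

(** The weight of each Dirac mass vanishes off Y, so the result is a measure on all of X carried by
    Y, which is how [prob_on] represents measures on Y. *)
Definition empirical : {measure set X -> \bar R} :=
  msum (fun k => mscale ((z k \in Y)%:R / n%:R)%:nng (dirac (z k))) t.+1.

Lemma empiricalE A : empirical A =
  (n%:R^-1 * \sum_(k < t.+1) (z k \in Y)%:R * \1_A (z k))%:E.
Proof.
rewrite /empirical /= /msum /= mulr_sumr -sumEFin; apply: eq_bigr => k _.
by rewrite /mscale /= diracE indicE -EFinM; congr _%:E; ring.
Qed.

Lemma empirical_sub A : A `<=` Y ->
  empirical A = (n%:R^-1 * \sum_(k < t.+1) \1_A (z k))%:E.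
Proof.
move=> AY; rewrite empiricalE; congr (_ * _)%:E; apply: eq_bigr => k _.
rewrite indicE; case: (boolP (z k \in A)); last by rewrite mulr0.
by rewrite inE => /AY/mem_set ->; rewrite mul1r.
Qed.

Lemma empirical_set1 A : Y `<=` A -> empirical A = 1%E.
Proof.
move=> YA; rewrite empiricalE; congr _%:E.
rewrite -[RHS](@mulVf _ n%:R) ?pnatr_eq0 -?lt0n//; congr (_ * _).
rewrite -zt /visits natr_sum; apply: eq_bigr => k _.
case: (boolP (z k \in Y)); last by rewrite mul0r.
by rewrite indicE inE => /YA/mem_set ->; rewrite mul1r.
Qed.

Lemma empirical_prob_on : exists mu : prob_on Y, forall A, prob_on_val mu A = empirical A.
Proof.
pose p : probability X R := HB.pack (empirical : set X -> \bar R) empirical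
  (Measure_isProbability.Build d X R empirical (empirical_set1 (@subsetT _ _))).
have pY : [set mu : pprobability X R | mu Y = 1%E] p.
  exact: (empirical_set1 (@subset_refl _ _)).
by exists (SigSub (mem_set pY)).
Qed.

Lemma Rintegral_empirical (mu : prob_on Y) (f : X -> R) :
  (forall A, measurable A -> A `<=` Y -> prob_on_val mu A = empirical A) ->
  {within Y, continuous f} ->
  \int[prob_on_val mu]_(x in Y) f x =
    n%:R^-1 * \sum_(k < t.+1) (z k \in Y)%:R * f (z k).
Proof.
move=> muE cf; have mY : measurable Y by exact: is_borel_compact.
have [M M0 fM] := within_continuous_bounded cY cf.
have muY : prob_on_val mu Y = 1%E := set_valP mu.
(* Shifting by M makes the integrand nonnegative, as needed for integration against a sum of
   measures; the shift cancels because the total mass on Y is one. *)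
apply: (addIr M); apply: (mulfI (oner_neq0 R)).
rewrite -Rintegral_affine//.
have mfM : measurable_fun Y (fun x => (1 * (f x + M))%:E).
  apply/measurable_EFinP; apply: within_continuous_measurable => //.
  exact: within_continuous_affine.
have fM0 x : Y x -> (0 <= (1 * (f x + M))%:E)%E.
  by move=> /fM; rewrite ler_norml lee_fin mul1r => /andP[]; lra.
rewrite /Rintegral (@eq_measure_integral _ _ _ _ empirical); last first.
  by move=> A mA AY; exact: muE.
rewrite ge0_integral_measure_sum//.
rewrite (eq_bigr (fun k : 'I_t.+1 =>
    (n%:R^-1 * ((z k \in Y)%:R * (f (z k) + M)))%:E)); last first.
  move=> k _; rewrite ge0_integral_mscale// integral_dirac//.
  rewrite diracE -!EFinM; congr _%:E; case: (z k \in Y) => /=; ring.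
rewrite sumEFin/= mul1r -mulr_sumr.
have -> : \sum_(k < t.+1) (z k \in Y)%:R * (f (z k) + M) =
    \sum_(k < t.+1) (z k \in Y)%:R * f (z k) + n%:R * M.
  rewrite -zt /visits natr_sum mulr_suml -big_split/=.
  by apply: eq_bigr => k _; rewrite mulrDr.
rewrite mulrDr; congr (_ + _).
by rewrite mulrA mulVf ?mul1r// pnatr_eq0 -lt0n.
Qed.

End empirical_measure.

(** * Measurability of the occupation event *)

(** The interior is open, hence Borel, and is used to cut out cells; the second ball lets the
    triangle inequality pass through the centre [e i]. *)
Lemma separable_dense_sequence (d : measure_display) (R : realType)
    (X : measurableMetricType d R) : is_separable X ->
  exists e : nat -> X, forall (x : X) (r : R), 0 < r ->
    exists i, (ball (e i) r)° x /\ ball x r (e i).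
Proof.
move=> [D /countable_injP[g ginj] dD].
have /choice[e he] (i : nat) : exists x, (exists2 y, D y & g y = i) -> D x /\ g x = i.
  have [[y Dy gy]|h] := pselect (exists2 y, D y & g y = i); first by exists y.
  by exists point => ?; exfalso; exact: h.
exists e => x r r0.
have [||y [By Dy]] := dD (ball x (r / 2))°.
- by exists x; apply: nbhsx_ballx; rewrite divr_gt0.
- exact: open_interior.
have ey : e (g y) = y.
  have [|Dy' gy'] := he (g y); first by exists y.
  by apply: ginj => //; rewrite inE.
have xy : ball x (r / 2) y by exact: interior_subset By.
exists (g y); rewrite ey; split; last by apply: le_ball xy; rewrite ler_pdivrMr//; lra.
apply: (@filterS _ (nbhs x) _ (ball x (r / 2))); last by apply: nbhsx_ballx; rewrite divr_gt0.
move=> z xz; rewrite [r]splitr; apply: ball_triangle xz; exact: ball_sym.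
Qed.

Section measurability.
Context (d d' : measure_display) (R : realType) (X : measurableMetricType d R)
  (Omega : measurableType d').
Variables (Z : nat -> {mfun Omega >-> X}) (Y : set X) (C : set (prob_on Y)) (n : nat).
Hypotheses (sX : is_separable X) (bX : is_borel X) (cY : compact Y) (n0 : (0 < n)%N).
Hypothesis clC : closed C.

(** A condition on a deterministic path, involving only its points up to time t, so that paths can
    be perturbed without reference to Omega. *)
Definition path_occupation t (z : nat -> X) : Prop := hit Y n z t /\
  exists2 mu : prob_on Y, C mu &
    forall A, measurable A -> A `<=` Y -> prob_on_val mu A = empirical Y z n t A.

Lemma occupation_in_path t w : hit Y n (Z ^~ w) t ->
  occupation_in Z n C w <-> path_occupation t (Z ^~ w).
Proof.
move=> ht; split=> [[mu Cmu muE]|[_ [mu Cmu muE]]].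
  split=> //; exists mu => // A mA AY.
  by rewrite empirical_sub// -muE// (trace_occupation_hit _ ht).
exists mu => // A mA AY.
by rewrite muE// empirical_sub// (trace_occupation_hit _ ht).
Qed.

Lemma eq_visits (z z' : nat -> X) t : (forall k, (k < t)%N -> (z' k \in Y) = (z k \in Y)) ->
  visits Y z' t = visits Y z t.
Proof. by move=> h; apply: eq_bigr => k _; rewrite h. Qed.

(** With the pattern of visits frozen, the n-th visit stays at time t and the empirical integrals of
    a test function are finite sums that converge term by term. The empirical measures converge
    weakly, and C is closed. *)
Lemma path_occupation_limit t (z : nat -> X) (zj : nat -> nat -> X) :
  (forall j k, (k <= t)%N -> (zj j k \in Y) = (z k \in Y)) ->
  (forall k, (k <= t)%N -> zj j k @[j --> \oo] --> z k) ->
  (forall j, path_occupation t (zj j)) -> path_occupation t z.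
Proof.
move=> zY zc pz.
have ht : hit Y n z t.
  have [[ztY vt] _] := pz 0%N; split; first by rewrite -(zY 0%N).
  by rewrite -vt; congr _.+1; apply/esym/eq_visits => k /ltnW; exact: zY.
have [rho rhoE] := empirical_prob_on n0 (hit_visits ht).
have /choice[mu hmu] j : exists mu : prob_on Y, C mu /\
    forall A, measurable A -> A `<=` Y -> prob_on_val mu A = empirical Y (zj j) n t A.
  by have [_ [mu]] := pz j; exists mu.
split => //; exists rho; last by move=> A _ _; exact: rhoE.
suff murho : mu j @[j --> \oo] --> rho.
  have nC : \forall j \near \oo, C (mu j) by apply: nearW => j; have [] := hmu j.
  exact: closed_cvg clC nC _ murho.
apply/cvg_test_integralsP => -[f cf].
rewrite /test_integrals/= (Rintegral_empirical bX cY n0 (hit_visits ht))//.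
set l := (X in _ --> X).
change ((fun j => \int[prob_on_val (mu j)]_(x in Y) f x) @ \oo --> l); rewrite {}/l.
have -> : (fun j => \int[prob_on_val (mu j)]_(x in Y) f x) =
    (fun j => n%:R^-1 * \sum_(k < t.+1) (z k \in Y)%:R * f (zj j k)).
  apply/funext => j; have [htj _] := pz j; have [_ muE] := hmu j.
  rewrite (Rintegral_empirical bX cY n0 (hit_visits htj))//; congr (_ * _).
  by apply: eq_bigr => k _; rewrite zY// -ltnS.
apply: cvgM; first exact: cvg_cst.
have term (k : 'I_t.+1) : (z k \in Y)%:R * f (zj j k) @[j --> \oo] --> (z k \in Y)%:R * f (z k).
  have kt : (k <= t)%N by rewrite -ltnS.
  case: (boolP (z k \in Y)) => zkY; last first.
    by rewrite mul0r; under eq_fun do rewrite mul0r; exact: cvg_cst.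
  apply: cvgM; first exact: cvg_cst.
  have Yzk : Y (z k) by rewrite inE in zkY.
  have fc : f @ within Y (nbhs (z k)) --> f (z k).
    by rewrite (nbhs_subspace_in Yzk); exact: (cf (z k)).
  apply: cvg_comp fc => A; rewrite /within/= => hA.
  have h : \forall j \near \oo, Y (zj j k) -> A (zj j k) := zc k kt _ hA.
  change (\forall j \near \oo, A (zj j k)); apply: filterS h => j; apply.
  by have := zY j k kt; rewrite zkY => /set_mem.
elim: (t.+1) term => [|m IH] term.
  by rewrite big_ord0; under eq_fun do rewrite big_ord0; exact: cvg_cst.
rewrite big_ord_recr/=; under eq_fun do rewrite big_ord_recr/=.
by apply: cvgD; [apply: IH => k; exact: (term (widen_ord (leqnSn m) k))|exact: (term ord_max)].
Qed.

(** The complement is a countable union of cylinders. A code gives, for each time up to t, a centre,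
    a radius 1/(j+1) and the side of Y. If every coded cylinder around a path meets the event, then
    paths of the event with the same visit pattern converge to it, and it belongs to the event by
    [path_occupation_limit]. *)
Lemma measurable_path_occupation t :
  measurable [set w | path_occupation t (Z ^~ w)].
Proof.
have [e he] := separable_dense_sequence sX.
pose code := {ffun 'I_t.+1 -> nat * nat * bool}.
pose cell (c : nat * nat * bool) : set X :=
  (ball (e c.1.1) (c.1.2.+1%:R^-1))° `&` (if c.2 then Y else ~` Y).
pose cyl (c : code) : set (nat -> X) := [set z | forall k : 'I_t.+1, cell (c k) (z k)].
pose good (c : code) := cyl c `&` path_occupation t = set0.
rewrite -[X in measurable X]setCK; apply: measurableC.
have mcell c : measurable (cell c).
  apply: measurableI; first by apply: is_borel_open => //; exact: open_interior.
  have mY : measurable Y by exact: is_borel_compact.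
  by case: ifP => _ //; exact: measurableC.
have mcyl c : measurable [set w | cyl c (Z ^~ w)].
  have -> : [set w | cyl c (Z ^~ w)] =
      \bigcap_(k in [set: 'I_t.+1]) (Z k @^-1` cell (c k)).
    by apply/seteqP; split => [w h k _|w h k]; [exact: h|exact: (h k I)].
  apply: fin_bigcap_measurable; first exact: finite_finset.
  by move=> k _; rewrite -[X in measurable X]setTI; exact: measurable_funP.
have -> : ~` [set w | path_occupation t (Z ^~ w)] =
    \bigcup_(c in [set: code]) (if pselect (good c) then [set w | cyl c (Z ^~ w)] else set0).
  apply/seteqP; split=> [w nw|w [c _]]; last first.
    case: pselect => //= gc cw pw.
    by have : (cyl c `&` path_occupation t) (Z ^~ w) by []; rewrite gc.
  apply: contrapT => nu; apply: nw => /=.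
  have /choice[zj hzj] (j : nat) : exists z' : nat -> X, path_occupation t z' /\
      forall k, (k <= t)%N -> (z' k \in Y) = (Z k w \in Y) /\
        ball (Z k w) (2 * j.+1%:R^-1) (z' k).
    have r0 : 0 < j.+1%:R^-1 :> R by [].
    have /choice[i hi] (k : 'I_t.+1) := he (Z k w) _ r0.
    pose c : code := [ffun k => (i k, j, Z k w \in Y)].
    have cw : cyl c (Z ^~ w).
      move=> k; rewrite /cell ffunE/=; have [h1 _] := hi k; split => //.
      by case: ifPn => [/set_mem//|/negP h]; move=> Yk; apply: h; rewrite inE.
    have [gc|] := pselect (good c).
      by exfalso; apply: nu; exists c => //; case: pselect.
    move=> /eqP/set0P[z' [cz' pz']]; exists z'; split => // k kt.
    have := cz' (Ordinal (kt : (k < t.+1)%N)); rewrite /cell ffunE/= => -[b1 b2]; split.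
      case: (boolP (Z k w \in Y)) b2 => _ b2; first exact: mem_set.
      by apply/negbTE/negP => /set_mem.
    have [_ b3] := hi (Ordinal (kt : (k < t.+1)%N)).
    (* The factor 2 comes from passing through the centre of the cell, at distance below 1/(j+1)
       from both points. *)
    rewrite mulr_natl mulr2n; apply: ball_triangle b3 _; exact: interior_subset b1.
  apply: (@path_occupation_limit t _ zj).
  - by move=> j k kt; have [_ h] := hzj j; have [] := h k kt.
  - move=> k kt; apply/cvg_ballP => eps eps0.
    have eps2 : 0 < eps / 2 by rewrite divr_gt0.
    have := near_infty_natSinv_lt (PosNum eps2); apply: filterS => j /= je.
    have [_ h] := hzj j; have [_ b] := h k kt.
    by apply: le_ball b; rewrite mulrC -ler_pdivlMr// ltW.
  - by move=> j; have [] := hzj j.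
apply: countable_bigcupT_measurable; first exact: countableP.
by move=> c; case: pselect => //= _; exact: mcyl.
Qed.

Lemma occupation_in_bigcup :
  occupation_in Z n C = \bigcup_t [set w | path_occupation t (Z ^~ w)].
Proof.
apply/seteqP; split=> [w ow|w [t _ pw]]; last first.
  by have [ht _] := pw; apply/(occupation_in_path ht).
have [|t ht] := occupation_in_hit _ n0 ow; first exact: is_borel_compact.
by exists t => //; exact/(occupation_in_path ht).
Qed.

End measurability.

Lemma is_borel_continuous (d : measure_display) (R : realType)
    (X : measurableMetricType d R) (f : X -> R) :
  is_borel X -> continuous f -> measurable_fun setT f.
Proof.
move=> bX /continuousP cf; apply: (measurability _ (RGenOpens.measurableE R)).
move=> _ [_ [a [b ->] <-]]; rewrite setTI; apply: is_borel_open => //.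
by apply: cf; exact: interval_open.
Qed.

(** * The transition operator as an integral against the kernel *)

Section transition_operator.
Context (d d' : measure_display) (R : realType) (X : measurableMetricType d R)
  (Omega : measurableType d').
Variables (K : R.-pker X ~> X) (P : X -> probability Omega R)
  (Z : nat -> {mfun Omega >-> X}).
Hypotheses (mZ : is_markov_chain K P Z) (bX : is_borel X).

Lemma measurable_point (x : X) : measurable [set x].
Proof. by apply: is_borel_compact => //; exact: compact_set1. Qed.

Lemma integral_start x (h : X -> \bar R) : measurable_fun setT h ->
  (forall y, 0 <= h y)%E -> (\int[P x]_w h (Z 0 w) = h x)%E.
Proof.
move=> mh h0; have [st _] := mZ; have mx := measurable_point x.
have mA : measurable (Z 0 @^-1` [set x]).
  by rewrite -[X in measurable X]setTI; exact: measurable_funP.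
transitivity (\int[P x]_w (cst (h x) w))%E; last first.
  rewrite integral_cst// [X in (_ * X)%E](_ : _ = 1%E) ?mule1//; exact: probability_setT.
apply: ge0_ae_eq_integral => //.
- exact: measurableT_comp.
- by move=> w _; exact: h0.
change ((P x).-negligible (~` [set w | setT w -> h (Z 0 w) = h x])).
exists (~` (Z 0 @^-1` [set x])); split; first exact: measurableC.
  by rewrite probability_setC// st subee.
by move=> w /= nh Zw; apply: nh => _; rewrite Zw.
Qed.

(** The Markov property at time 0 turns the expectation of u(Z_1) into that of the kernel integral
    at Z_0, and Z_0 is x almost surely. *)
Lemma transition_opE (u : X -> R) (M : R) x : measurable_fun setT u ->
  (forall y, 0 <= u y <= M) ->
  (transition_op P Z u x)%:E = (\int[K x]_y (u y)%:E)%E.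
Proof.
move=> mu uM; have mEu : measurable_fun setT (EFin \o u) by exact/measurable_EFinP.
have u0 y : (0 <= (EFin \o u) y)%E by rewrite lee_fin; have /andP[] := uM y.
have -> : (\int[K x]_y (u y)%:E = 'E_(P x)[u \o Z 1%N])%E.
  rewrite unlock.
  have pT : past Z 0 setT by exact: (@measurableT _ (pastType Z 0)).
  have -> := markov_integral_past mZ x pT mEu u0.
  rewrite (@integral_start x (fun x => \int[K x]_y (EFin \o u) y)%E)//.
    apply: measurable_fun_integral_kernel => // U mU; exact: measurable_kernel.
  by move=> y; exact: integral_ge0.
rewrite /transition_op fineK// unlock ge0_fin_numE; last first.
  by apply: integral_ge0 => w _; exact: u0.
apply: (@le_lt_trans _ _ (\int[P x]_w M%:E)%E); last first.
  rewrite integral_cst// [X in (_ * X)%E](_ : _ = 1%E) ?mule1 ?ltry//; exact: probability_setT.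
apply: ge0_le_integral => //.
- by move=> w _; exact: u0.
- exact: (measurableT_comp (f := EFin \o u) (proj2 (measurable_EFinP _ _) mu)).
- by move=> w _; rewrite lee_fin; have /andP[] := uM (Z 1%N w).
Qed.

(** Here u dominates c times the indicator of Yt, and Z_1 is in Yt almost surely. With Yt the whole
    space this gives positivity of [pi u]; with the given set it bounds [pi u] on Y. *)
Lemma transition_op_ge (u : X -> R) (M c : R) x (Yt : set X) :
  measurable_fun setT u -> (forall y, 0 <= u y <= M) -> 0 <= c ->
  measurable Yt -> P x (Z 1%N @^-1` Yt) = 1%E -> (forall y, Yt y -> c <= u y) ->
  c <= transition_op P Z u x.
Proof.
move=> mu uM c0 mYt PYt cu.
have fin : ('E_(P x)[u \o Z 1%N] \is a fin_num)%E.
  rewrite unlock ge0_fin_numE; last first.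
    by apply: integral_ge0 => w _; rewrite lee_fin; have /andP[] := uM (Z 1%N w).
  apply: (@le_lt_trans _ _ (\int[P x]_w M%:E)%E); last first.
    rewrite integral_cst// [X in (_ * X)%E](_ : _ = 1%E) ?mule1 ?ltry//; exact: probability_setT.
  apply: ge0_le_integral => //.
  - by move=> w _; rewrite lee_fin; have /andP[] := uM (Z 1%N w).
  - exact: (measurableT_comp (f := EFin \o u) (proj2 (measurable_EFinP _ _) mu)).
  - by move=> w _; rewrite lee_fin; have /andP[] := uM (Z 1%N w).
rewrite -lee_fin /transition_op fineK// unlock.
have mA : measurable (Z 1%N @^-1` Yt).
  by rewrite -[X in measurable X]setTI; exact: measurable_funP.
have -> : c%:E = (\int[P x]_w (c * \1_(Z 1%N @^-1` Yt) w)%:E)%E.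
  under eq_integral do rewrite EFinM.
  rewrite ge0_integralZl//.
  - by rewrite integral_indic// setIT [X in (_ * X)%E](_ : _ = 1%E)// mule1.
  - by apply/measurable_EFinP; exact: measurable_indic.
apply: ge0_le_integral => //.
- by move=> w _; rewrite lee_fin mulr_ge0.
- by apply/measurable_EFinP; apply: measurable_funM => //; exact: measurable_indic.
- exact: (measurableT_comp (f := EFin \o u) (proj2 (measurable_EFinP _ _) mu)).
- move=> w _; rewrite lee_fin /= indicE; case: (boolP (w \in _)) => [|_].
    by rewrite inE mulr1 => /cu.
  by rewrite mulr0; have /andP[] := uM (Z 1%N w).
Qed.

End transition_operator.

(** * The supermartingale stopped at the n-th visit *)

Section visit_bound.
Context (d d' : measure_display) (R : realType) (X : measurableMetricType d R)
  (Omega : measurableType d').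
Variables (K : R.-pker X ~> X) (P : X -> probability Omega R)
  (Z : nat -> {mfun Omega >-> X}) (Y : set X) (C : set (prob_on Y)) (n : nat).
Hypotheses (mZ : is_markov_chain K P Z) (sX : is_separable X) (bX : is_borel X).
Hypotheses (cY : compact Y) (n0 : (0 < n)%N) (clC : closed C).
Variables (u : X -> R) (c1 c2 : R).
Hypotheses (cu : continuous u) (c10 : 0 < c1) (uc : forall y, c1 <= u y <= c2).
Hypothesis cpu : continuous (transition_op P Z u).
Hypothesis upu : forall y, ~ Y y -> transition_op P Z u y <= u y.

Local Notation pu := (transition_op P Z u).

Let u_gt0 y : 0 < u y.
Proof. by have /andP[+ _] := uc y; apply: lt_le_trans. Qed.

Let u_bound y : 0 <= u y <= c2.
Proof. by have /andP[_ ->] := uc y; rewrite ltW. Qed.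

Let mu_ : measurable_fun setT u.
Proof. exact: is_borel_continuous. Qed.

Lemma transition_op_gt0 y : 0 < pu y.
Proof.
apply: lt_le_trans c10 _.
apply: (transition_op_ge (M := c2) (Yt := setT) mu_ u_bound) => //.
- exact: ltW.
- by rewrite preimage_setT; exact: probability_setT.
- by move=> z _; have /andP[] := uc z.
Qed.

(* The factor by which the chain is reweighted at x; it is at most u x / pi u x,
   with equality on Y. *)
Definition visit_factor (x : X) : R := 1 + \1_Y x * (u x / pu x - 1).

Lemma visit_factor_in x : Y x -> visit_factor x = u x / pu x.
Proof. by move=> Yx; rewrite /visit_factor indicE mem_set//= mul1r addrC subrK. Qed.

Lemma visit_factor_out x : ~ Y x -> visit_factor x = 1.
Proof. by move=> Yx; rewrite /visit_factor indicE memNset//= mul0r addr0. Qed.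

Lemma visit_factor_gt0 x : 0 < visit_factor x.
Proof.
have [Yx|nYx] := pselect (Y x); last by rewrite visit_factor_out.
by rewrite visit_factor_in// divr_gt0// transition_op_gt0.
Qed.

Lemma visit_factor_transition x : visit_factor x * pu x <= u x.
Proof.
have [Yx|nYx] := pselect (Y x); last by rewrite visit_factor_out// mul1r upu.
by rewrite visit_factor_in// divfK// gt_eqF// transition_op_gt0.
Qed.

Lemma measurable_visit_factor : measurable_fun setT visit_factor.
Proof.
apply: measurable_funD => //; apply: measurable_funM.
  by apply: measurable_indic; exact: is_borel_compact.
apply: measurable_funD => //; apply: is_borel_continuous => // x.
apply: cvgM; first exact: cu.
by apply: cvgV; [rewrite gt_eqF// transition_op_gt0|exact: cpu].
Qed.

(** The process V_t is [visit_weight t w * u (Z t w)]. Stopping the product before t makes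
    [visit_weight t.+1] a function of Z_0, ..., Z_t. *)
Definition visit_weight t w : R := \prod_(k < t) visit_factor (Z k w).

Lemma visit_weight_gt0 t w : 0 < visit_weight t w.
Proof. by apply: prodr_gt0 => k _; exact: visit_factor_gt0. Qed.

Lemma measurable_visit_weight t :
  measurable_fun setT (visit_weight t.+1 : pastType Z t -> R).
Proof.
apply: measurable_prod => k _.
apply: (measurableT_comp (f := visit_factor)); first exact: measurable_visit_factor.
by apply: measurable_fun_past; rewrite -ltnS.
Qed.

(** The event that no n-th visit occurs strictly before t. At [t.+1] it is decided by Z_0, ..., Z_t,
    so it can multiply the weight in [markov_integral]. *)
Definition before_hit t : set Omega := [set w | (visits Y (Z ^~ w) t < n)%N].

Lemma measurable_before_hit t :
  measurable (before_hit t.+1 : set (pastType Z t)).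
Proof.
pose v (w : pastType Z t) : R := \sum_(k < t.+1) \1_Y (Z k w).
have mv : measurable_fun setT v.
  apply: measurable_sum => k.
  apply: (measurableT_comp (f := \1_Y : X -> R)).
    by apply: measurable_indic; exact: is_borel_compact.
  by apply: measurable_fun_past; rewrite -ltnS.
have -> : before_hit t.+1 = setT `&` v @^-1` `]-oo, n%:R[%classic.
  rewrite setTI; apply/seteqP; split => w; rewrite /before_hit /= in_itv/= /v.
    have -> : \sum_(k < t.+1) \1_Y (Z k w) = (visits Y (Z ^~ w) t.+1)%:R :> R.
      by rewrite /visits natr_sum; apply: eq_bigr => k _; rewrite indicE.
    by rewrite ltr_nat.
  have -> : \sum_(k < t.+1) \1_Y (Z k w) = (visits Y (Z ^~ w) t.+1)%:R :> R.
    by rewrite /visits natr_sum; apply: eq_bigr => k _; rewrite indicE.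
  by rewrite ltr_nat.
by apply: mv => //; exact: measurable_itv.
Qed.

Lemma measurable_before_hitW t : measurable (before_hit t).
Proof.
case: t => [|t]; last first.
  by apply: (@past_measurable _ _ _ _ _ Z t); exact: measurable_before_hit.
have -> : before_hit 0 = setT; last exact: measurableT.
by apply/seteqP; split => // w _; rewrite /before_hit /= visits0.
Qed.

Lemma measurable_visit_weightW t : measurable_fun setT (visit_weight t).
Proof.
apply: measurable_prod => k _.
apply: (measurableT_comp (f := visit_factor)) => //; exact: measurable_visit_factor.
Qed.

Local Open Scope ereal_scope.

(** Conditioning on the past replaces u(Z_(t+1)) by [pi u] at Z_t; the factor at time t then brings
    it back below u(Z_t). *)
Lemma visit_supermartingale x t :
  \int[P x]_w (\1_(before_hit t.+1) w * visit_weight t.+1 w * u (Z t.+1 w))%:E <=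
  \int[P x]_w (\1_(before_hit t.+1) w * visit_weight t w * u (Z t w))%:E.
Proof.
pose G (w : pastType Z t) : \bar R := (\1_(before_hit t.+1) w * visit_weight t.+1 w)%:E.
have G0 w : 0 <= G w by rewrite lee_fin mulr_ge0// ltW// visit_weight_gt0.
have mG : measurable_fun setT G.
  apply/measurable_EFinP; apply: measurable_funM; last exact: measurable_visit_weight.
  by apply: measurable_indic; exact: measurable_before_hit.
have mEu : measurable_fun setT (EFin \o u) by exact/measurable_EFinP.
have h := markov_integral mZ x mG G0 mEu (M := c2) u_bound.
have -> : \int[P x]_w (\1_(before_hit t.+1) w * visit_weight t.+1 w * u (Z t.+1 w))%:E =
    \int[P x]_w (G w * (EFin \o u) (Z t.+1 w)) by [].
rewrite h; apply: ge0_le_integral => //.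
- by move=> w _; rewrite mule_ge0// integral_ge0// => y _; rewrite lee_fin ltW.
- apply: emeasurable_funM; first exact: measurable_pastType mG.
  apply: (measurableT_comp (f := fun x => \int[K x]_y (EFin \o u) y)) => //.
  apply: measurable_fun_integral_kernel => //; last by move=> y; rewrite lee_fin ltW.
  by move=> U mU; exact: measurable_kernel.
- apply/measurable_EFinP; apply: measurable_funM; last exact: measurableT_comp.
  apply: measurable_funM; last exact: measurable_visit_weightW.
  by apply: measurable_indic; exact: measurable_before_hitW.
- move=> w _; rewrite -(transition_opE mZ bX _ mu_ u_bound) -EFinM lee_fin.
  rewrite -!mulrA ler_wpM2l//.
  rewrite /visit_weight big_ord_recr/= -mulrA ler_wpM2l//.
    exact: ltW (visit_weight_gt0 t w).
  exact: visit_factor_transition.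
Qed.

Lemma measurable_hit t : measurable [set w | hit Y n (Z ^~ w) t].
Proof.
have -> : [set w | hit Y n (Z ^~ w) t] = before_hit t `\` before_hit t.+1.
  apply/seteqP; split => [w ht|w []].
    split; rewrite /before_hit /=; last by rewrite (hit_visits ht) ltnn.
    by case: ht => _ <-.
  rewrite /before_hit /= visitsS => lt /negP; rewrite -leqNgt.
  case: (boolP (Z t w \in Y)) => zY ge; last by move: ge; rewrite addn0 leqNgt lt.
  by split => //; apply/eqP; rewrite eqn_leq lt/= -addn1.
by apply: measurableD; exact: measurable_before_hitW.
Qed.

(** Optional stopping up to time T. The part of V_T before the hit splits into the paths hitting at
    T and the survivors, and the survivors pass to time T + 1 by [visit_supermartingale]. *)
Lemma hit_integral_sum x T :
  \sum_(t < T) \int[P x]_w (\1_[set w | hit Y n (Z ^~ w) t] w *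
    visit_weight t w * u (Z t w))%:E <= (u x)%:E.
Proof.
pose a t := \int[P x]_w (\1_(before_hit t) w * visit_weight t w * u (Z t w))%:E.
have mf t (A : set Omega) : measurable A ->
    measurable_fun setT (fun w => (\1_A w * visit_weight t w * u (Z t w))%:E).
  move=> mA; apply/measurable_EFinP; apply: measurable_funM; last exact: measurableT_comp.
  apply: measurable_funM; last exact: measurable_visit_weightW.
  exact: measurable_indic.
have f0 t (A : set Omega) w : 0 <= (\1_A w * visit_weight t w * u (Z t w))%:E.
  by rewrite lee_fin !mulr_ge0 ?indicE// ltW// visit_weight_gt0.
(* The induction needs the mass still waiting at time T, so the nonnegative remainder [a T] is
   added. *)
apply: (@le_trans _ _ (\sum_(t < T) \int[P x]_w (\1_[set w | hit Y n (Z ^~ w) t] w *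
    visit_weight t w * u (Z t w))%:E + a T)).
  by rewrite leeDl// /a; apply: integral_ge0 => w _; exact: f0.
elim: T => [|T IH].
  rewrite big_ord0 add0e /a.
  rewrite -[leRHS](integral_start mZ bX x (h := EFin \o u)); last 2 first.
  - exact/measurable_EFinP.
  - by move=> y; rewrite lee_fin ltW.
  apply: ge0_le_integral => //.
  + by apply: mf; exact: measurable_before_hitW.
  + by apply/measurable_EFinP; exact: measurableT_comp.
  + move=> w _; rewrite lee_fin /visit_weight big_ord0 mulr1.
    apply: ler_piMl; first exact: ltW.
    by rewrite indicE; case: (_ \in _).
apply: le_trans IH; rewrite big_ord_recr/= -addeA leeD2l//.
apply: (@le_trans _ _ (\int[P x]_w (\1_[set w | hit Y n (Z ^~ w) T] w *
    visit_weight T w * u (Z T w))%:E +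
    \int[P x]_w (\1_(before_hit T.+1) w * visit_weight T w * u (Z T w))%:E)).
  by apply: leeD => //; exact: visit_supermartingale.
rewrite -ge0_integralD//; last 2 first.
- by apply: mf; exact: measurable_hit.
- by apply: mf; exact: measurable_before_hitW.
apply: ge0_le_integral => //.
- by move=> w _; rewrite adde_ge0.
- by apply: emeasurable_funD; apply: mf; [exact: measurable_hit|exact: measurable_before_hitW].
- by apply: mf; exact: measurable_before_hitW.
move=> w _; rewrite -EFinD lee_fin -!mulrDl; apply: ler_wpM2r; first exact: ltW.
apply: ler_wpM2r; first exact: ltW (visit_weight_gt0 _ _).
rewrite !indicE.
have [ht|nht] := pselect (hit Y n (Z ^~ w) T).
  rewrite (@mem_set _ [set w | _] w ht) (@memNset _ (before_hit T.+1)) ?addr0.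
    by rewrite mem_set// /before_hit /=; case: ht => _ <-.
  by rewrite /before_hit /= (hit_visits ht) ltnn.
rewrite (@memNset _ [set w | _] w nht) add0r.
case: (boolP (w \in before_hit T.+1)) => //= /set_mem; rewrite /before_hit /= => lt.
by rewrite mem_set// /before_hit /=; apply: leq_ltn_trans lt; exact: leq_visits.
Qed.

Variables (c a : R).
Hypothesis c0 : (0 <= c)%R.
Hypothesis cpuY : forall y, Y y -> (c <= pu y)%R.
Hypothesis aC : forall mu, C mu ->
  (a <= \int[prob_on_val mu]_(x in Y) - ln (pu x / u x))%R.

Lemma visit_weight_lower t w : path_occupation C n t (Z ^~ w) ->
  (c * expR (n%:R * a) <= visit_weight t w * u (Z t w))%R.
Proof.
move=> [ht [mu Cmu muE]].
have cf : {within Y, continuous (fun x => - ln (pu x / u x) : R)%R}.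
  apply: continuous_subspaceT => x.
  have pos : (0 < pu x / u x)%R by rewrite divr_gt0// transition_op_gt0.
  apply: cvgN; apply: (@continuous_comp _ _ _ (fun x => pu x / u x)%R (@ln R)).
    by apply: cvgM; [exact: cpu|apply: cvgV; [rewrite gt_eqF|exact: cu]].
  exact: continuous_ln.
have ZtY : Y (Z t w) by case: ht => /set_mem.
(* Since Z_t lies in Y, u there is [pi u] times the visit factor at time t, which completes the
   product through the n-th visit. *)
have -> : (visit_weight t w * u (Z t w) = pu (Z t w) * visit_weight t.+1 w)%R.
  rewrite /visit_weight big_ord_recr/= mulrCA visit_factor_in//; congr (_ * _)%R.
  by rewrite mulrC divfK// gt_eqF// transition_op_gt0.
have -> : visit_weight t.+1 w =
    expR (n%:R * \int[prob_on_val mu]_(x in Y) - ln (pu x / u x))%R.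
  rewrite (Rintegral_empirical bX cY n0 (hit_visits ht) muE cf).
  rewrite mulrA divff ?pnatr_eq0 -?lt0n// mul1r expR_sum.
  apply: eq_bigr => k _; case: (boolP (Z k w \in Y)) => [/set_mem|/negP] Yk.
    rewrite mul1r expRN lnK ?posrE; last by rewrite divr_gt0// transition_op_gt0.
    by rewrite invf_div visit_factor_in.
  by rewrite mul0r expR0 visit_factor_out// => /mem_set.
apply: ler_pM => //; [exact: cpuY|].
by rewrite ler_expR ler_wpM2l// aC.
Qed.

(** The event is split by the time t of the n-th visit. On each piece the constant is at most V_t,
    and the expectations of V at the hits add up to at most u x. *)
Lemma occupation_bound x :
  (c * expR (n%:R * a))%:E * P x (occupation_in Z n C) <= (u x)%:E.
Proof.
pose E t := [set w | path_occupation C n t (Z ^~ w)].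
have mE t : measurable (E t) by exact: measurable_path_occupation.
have b0 : (0 <= c * expR (n%:R * a))%R by rewrite mulr_ge0// expR_ge0.
rewrite (occupation_in_bigcup Z C bX cY n0) -/E.
apply: (@le_trans _ _ ((c * expR (n%:R * a))%:E * \sum_(0 <= t <oo) P x (E t))).
  apply: lee_wpmul2l; first by rewrite lee_fin.
  apply: generalized_Boole_inequality => //.
  by apply: bigcup_measurable => t _; exact: mE.
rewrite -nneseriesZl//.
apply: lime_le; first by apply: is_cvg_nneseries => t _ _; rewrite mule_ge0// lee_fin.
apply: nearW => T; rewrite big_mkord; apply: le_trans (hit_integral_sum x T).
apply: lee_sum => t _.
have -> : P x (E t) = \int[P x]_w (\1_(E t) w : R)%:E by rewrite integral_indic// setIT.
rewrite -ge0_integralZl//; last first.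
  by apply/measurable_EFinP; exact: measurable_indic.
apply: ge0_le_integral => //.
- by move=> w _; rewrite mule_ge0// lee_fin.
- by apply: emeasurable_funM => //; apply/measurable_EFinP; exact: measurable_indic.
- apply/measurable_EFinP; apply: measurable_funM; last exact: measurableT_comp.
  apply: measurable_funM; last exact: measurable_visit_weightW.
  by apply: measurable_indic; exact: measurable_hit.
move=> w _; rewrite -EFinM lee_fin !indicE.
case: (boolP (w \in E t)) => [/set_mem Ew|_]; last first.
  by rewrite mulr0 !mulr_ge0// ltW// visit_weight_gt0.
have [ht _] := Ew; rewrite (@mem_set _ [set w | _] w ht) mulr1 mul1r.
exact: visit_weight_lower.
Qed.

End visit_bound.

(** * The rate function *)

Section rate_function.
Context (d d' : measure_display) (R : realType) (X : measurableMetricType d R)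
  (Omega : measurableType d').
Variables (K : R.-pker X ~> X) (P : X -> probability Omega R)
  (Z : nat -> {mfun Omega >-> X}) (Y : set X).
Hypotheses (mZ : is_markov_chain K P Z) (bX : is_borel X) (cY : compact Y).
Hypothesis feller : forall u : X -> R, continuous u ->
  [bounded u x | x in [set: X]] -> continuous (transition_op P Z u).

Local Notation pi := (transition_op P Z).

Definition rate_integrand (u : X -> R) (x : X) : R := - ln (pi u x / u x).

Lemma S_star_transition u : S_star pi Y u ->
  [/\ continuous (pi u), forall x, 0 < u x & forall x, 0 < pi u x].
Proof.
move=> [cu [c1 [c2 [c10 uc]]] _]; split.
- apply: feller => //; exists c2; split; first exact: num_real.
  move=> M c2M x _ /=; have /andP[h1 h2] := uc x.
  by rewrite ger0_norm; [apply: le_trans h2 (ltW c2M)|apply: le_trans (ltW c10) h1].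
- by move=> x; have /andP[h1 _] := uc x; exact: lt_le_trans h1.
- move=> x; exact: (transition_op_gt0 _ _ bX cu c10 uc).
Qed.

Lemma continuous_rate_integrand u : S_star pi Y u -> continuous (rate_integrand u).
Proof.
move=> uS x; have [cpu u0 pu0] := S_star_transition uS; have [cu _ _] := uS.
have pos : 0 < pi u x / u x by rewrite divr_gt0.
apply: cvgN; apply: (@continuous_comp _ _ _ (fun x => pi u x / u x) (@ln R)).
  by apply: cvgM; [exact: cpu|apply: cvgV; [rewrite gt_eqF|exact: cu]].
exact: continuous_ln.
Qed.

Lemma Rintegral_lincomb (mu : probability X R) (I : eqType) (s : seq I) (l : I -> R)
    (f : I -> X -> R) : {in s, forall i, {within Y, continuous (f i)}} ->
  {within Y, continuous (fun x => \sum_(i <- s) l i * f i x)} /\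
  \int[mu]_(x in Y) (\sum_(i <- s) l i * f i x) =
    \sum_(i <- s) l i * \int[mu]_(x in Y) f i x.
Proof.
have mY : measurable Y by exact: is_borel_compact.
elim: s => [|i s IH] cf.
  split; first by under eq_fun do rewrite big_nil; move=> x; exact: cvg_cst.
  under eq_Rintegral do rewrite big_nil.
  by rewrite big_nil Rintegral_cst// mul0r.
have ci : {within Y, continuous (f i)} by apply: cf; rewrite mem_head.
have [|cs Is] := IH; first by move=> j js; apply: cf; rewrite inE js orbT.
have cli : {within Y, continuous (fun x => l i * f i x)}.
  by move=> x; apply: cvgM; [exact: cvg_cst|exact: ci].
have E : (fun x => \sum_(j <- i :: s) l j * f j x) =
    (fun x => l i * f i x + \sum_(j <- s) l j * f j x).
  by apply/funext => x; rewrite big_cons.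
rewrite E; split; first by move=> x; apply: cvgD; [exact: cli|exact: cs].
rewrite big_cons RintegralD//; try exact: within_continuous_integrable.
rewrite RintegralZl//; last exact: within_continuous_integrable.
by rewrite Is.
Qed.

Lemma continuous_sum_ln (s : seq (X -> R)) (l : (X -> R) -> R) :
  (forall u, u \in s -> continuous u) -> (forall u y, u \in s -> 0 < u y) ->
  continuous (fun x => \sum_(u <- s) l u * ln (u x)).
Proof.
elim: s => [|u s' IH] cs s0 y.
  by under eq_fun do rewrite big_nil; exact: cvg_cst.
under eq_fun do rewrite big_cons.
apply: cvgD.
  apply: cvgM; first exact: cvg_cst.
  apply: (@continuous_comp _ _ _ u (@ln R)); first by apply: cs; rewrite mem_head.
  by apply: continuous_ln; apply: s0; rewrite mem_head.
apply: IH => w; first by move=> ws; apply: cs; rewrite inE ws orbT.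
by move=> z ws; apply: s0; rewrite inE ws orbT.
Qed.

(** * Geometric means of functions in [S_star] *)

Section log_concavity.
Variables (s : seq (X -> R)) (l : (X -> R) -> R).
Hypotheses (sS : {in s, forall u, S_star pi Y u}) (l0 : forall u, 0 <= l u).
Hypothesis l1 : \sum_(u <- s) l u = 1.

Let v (x : X) : R := expR (\sum_(u <- s) l u * ln (u x)).

Lemma common_bounds : exists c1 c2 : R, 0 < c1 /\
  {in s, forall u, forall y, c1 <= u y <= c2}.
Proof.
elim: s sS => [|u s' IH] hs; first by exists 1, 1.
have [|c1 [c2 [c10 uc]]] := IH; first by move=> w ws; apply: hs; rewrite inE ws orbT.
have [_ [e1 [e2 [e10 ue]]] _] : S_star pi Y u by apply: hs; rewrite mem_head.
exists (Num.min c1 e1), (Num.max c2 e2); split; first by rewrite lt_min c10.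
move=> w; rewrite inE => /orP[/eqP ->|ws] y; rewrite ge_min le_max.
  by have /andP[-> ->] := ue y; rewrite !orbT.
by have /andP[-> ->] := uc w ws y.
Qed.

Lemma continuous_log_mean : continuous v.
Proof.
move=> y; apply: (@continuous_comp _ _ _ (fun x => \sum_(u <- s) l u * ln (u x)) (@expR R));
  last exact: continuous_expR.
apply: continuous_sum_ln => [u /sS[]//|u z us].
by have [_ u0 _] := S_star_transition (sS us).
Qed.

(** Hölder's inequality for the kernel. Jensen applied to the normalised ratios [u y / pi u x]
    bounds v y by [expR m] times their weighted mean; under the kernel each ratio integrates to one
    and the weights sum to one. *)
Lemma log_mean_transition x : pi v x <= expR (\sum_(u <- s) l u * ln (pi u x)).
Proof.
have [c1 [c2 [c10 uc]]] := common_bounds.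
set m := \sum_(u <- s) _.
have cu u : u \in s -> continuous u by move=> us; have [] := sS us.
have pu0 u : u \in s -> 0 < pi u x by move=> /sS/S_star_transition[].
have u0 u y : u \in s -> 0 < u y.
  by move=> us; have /andP[+ _] := uc u us y; apply: lt_le_trans.
have vle y : v y <= \sum_(u <- s) (expR m * l u / pi u x) * u y.
  have -> : v y = expR m * expR (\sum_(u <- s) l u * (ln (u y) - ln (pi u x))).
    rewrite -expRD; congr expR; rewrite /m -big_split/=.
    by apply: eq_bigr => u _; ring.
  apply: (@le_trans _ _ (expR m * \sum_(u <- s) l u * expR (ln (u y) - ln (pi u x)))).
    by rewrite ler_wpM2l ?expR_ge0//; exact: expR_convex_sum.
  rewrite mulr_sumr le_eqVlt; apply/orP; left; apply/eqP.
  rewrite big_seq [RHS]big_seq; apply: eq_bigr => u us.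
  have E1 : expR (ln (u y)) = u y by apply: lnK; rewrite posrE u0.
  have E2 : expR (ln (pi u x)) = pi u x by apply: lnK; rewrite posrE pu0.
  by rewrite expRB E1 E2; ring.
have cb u : u \in s -> forall y, 0 <= u y <= c2.
  by move=> us y; have /andP[_ ->] := uc u us y; rewrite ltW// u0.
have vb y : 0 <= v y <= \sum_(u <- s) (expR m * l u / pi u x) * c2.
  rewrite expR_ge0; apply: le_trans (vle y) _.
  rewrite big_seq [leRHS]big_seq; apply: ler_sum => u us.
  apply: ler_wpM2l; last by have /andP[] := cb u us y.
  by rewrite divr_ge0 ?mulr_ge0 ?expR_ge0// ltW// pu0.
have mv : measurable_fun setT v by apply: is_borel_continuous => //; exact: continuous_log_mean.
rewrite -lee_fin (transition_opE mZ bX x mv vb).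
(* Sign and measurability are known only for members of s; the value 0 elsewhere makes every term of
   the family nonnegative and measurable. *)
pose g (u : X -> R) y : \bar R := if u \in s then ((expR m * l u / pi u x) * u y)%:E else 0%E.
have -> : expR m = \sum_(u <- s) (expR m * l u).
  by rewrite -mulr_sumr l1 mulr1.
have mg u : measurable_fun setT (g u).
  rewrite /g; case: (boolP (u \in s)) => us //; apply/measurable_EFinP; apply: measurable_funM => //.
  by apply: is_borel_continuous => //; exact: cu.
have g0 u y : (0 <= g u y)%E.
  rewrite /g; case: (boolP (u \in s)) => us //; rewrite lee_fin.
  apply: mulr_ge0; last exact/ltW/u0.
  by rewrite divr_ge0 ?mulr_ge0 ?expR_ge0// ltW// pu0.
apply: (@le_trans _ _ (\int[K x]_y (\sum_(u <- s) g u y)%E)%E).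
  apply: ge0_le_integral => //.
  - by move=> y _; rewrite lee_fin expR_ge0.
  - exact/measurable_EFinP.
  - exact: emeasurable_sum.
  - move=> y _; apply: (@le_trans _ _ (\sum_(u <- s) (expR m * l u / pi u x) * u y)%:E).
      by rewrite lee_fin.
    rewrite -sumEFin big_seq [leRHS]big_seq; apply: lee_sum => u us.
    by rewrite /g us.
rewrite ge0_integral_sum// -sumEFin big_seq [leRHS]big_seq; apply: lee_sum => u us.
have mEu : measurable_fun setT (fun y => (u y)%:E).
  by apply/measurable_EFinP; apply: is_borel_continuous => //; exact: cu.
under eq_integral do rewrite /g us EFinM.
rewrite ge0_integralZl//; last 2 first.
- by move=> y _; rewrite lee_fin ltW// u0.
- by rewrite lee_fin divr_ge0 ?mulr_ge0 ?expR_ge0// ltW// pu0.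
rewrite -(transition_opE mZ bX x _ (cb u us)); last exact/measurable_EFinP.
by rewrite -EFinM lee_fin divfK// gt_eqF// pu0.
Qed.

Lemma log_mean_S_star : S_star pi Y v.
Proof.
have [c1 [c2 [c10 uc]]] := common_bounds.
have u0 u y : u \in s -> 0 < u y.
  by move=> us; have /andP[+ _] := uc u us y; apply: lt_le_trans.
split; first exact: continuous_log_mean.
(* The maximum with c1 makes the upper constant positive, so that it can be written as exp of a
   weighted mean of its own logarithm. *)
- exists c1, (Num.max c1 c2); split=> // y.
  have c20 : 0 < Num.max c1 c2 by rewrite lt_max c10.
  have cst_mean c : 0 < c -> c = expR (\sum_(u <- s) l u * ln c).
    by move=> c0; rewrite -mulr_suml l1 mul1r lnK.
  rewrite {1}(cst_mean _ c10) [X in _ <= _ <= X](cst_mean _ c20) !ler_expR.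
  apply/andP; split; rewrite big_seq [leRHS]big_seq; apply: ler_sum => u us;
    apply: ler_wpM2l => //; have /andP[h1 h2] := uc u us y.
    by rewrite ler_ln ?posrE// u0.
  by rewrite ler_ln ?posrE ?u0// le_max h2 orbT.
- move=> y nYy; apply: le_trans (log_mean_transition y) _; rewrite ler_expR.
  rewrite big_seq [leRHS]big_seq; apply: ler_sum => u us; apply: ler_wpM2l => //.
  have [_ _ /(_ y)] := S_star_transition (sS us) => pu0.
  have piu : pi u y <= u y by have [_ _ h] := sS us; exact: (h y nYy).
  have ui : 0 < u y by exact: u0.
  by rewrite ler_ln ?posrE.
Qed.

(** The term ln v is exactly the weighted mean of the ln u, so all the slack comes from
    [log_mean_transition]. *)
Lemma rate_integrand_concave x :
  \sum_(u <- s) l u * rate_integrand u x <= rate_integrand v x.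
Proof.
have [_ v0 pv0] := S_star_transition log_mean_S_star.
rewrite /rate_integrand ln_div ?posrE// opprB expRK lerBrDr.
have : ln (pi v x) <= \sum_(u <- s) l u * ln (pi u x).
  by rewrite -[leRHS]expRK ler_ln ?posrE// ?expR_gt0// log_mean_transition.
move=> h; apply: (@le_trans _ _ (\sum_(u <- s) l u * - ln (pi u x / u x) +
    \sum_(u <- s) l u * ln (pi u x))); first by rewrite lerD2l.
rewrite -big_split/= big_seq [leRHS]big_seq; apply: ler_sum => u us.
have [_ u0 pu0] := S_star_transition (sS us).
by rewrite -mulrDr ler_wpM2l// ln_div ?posrE// opprB subrK.
Qed.

End log_concavity.
End rate_function.

Section mixture.
Context (d : measure_display) (R : realType) (X : measurableMetricType d R).
Variables (Y : set X).
Hypotheses (bX : is_borel X) (cY : compact Y).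

(** The first clause is the form in which [convex_prob] recognises the mixture; the second makes the
    integrals affine in the measure, as the minimax requires. *)
Lemma prob_on_mixture (mu nu : prob_on Y) (t : R) : 0 <= t <= 1 ->
  exists rho : prob_on Y,
    (forall A, prob_on_val rho A =
      t%:E * prob_on_val mu A + (1 - t)%:E * prob_on_val nu A)%E /\
    forall f : X -> R, {within Y, continuous f} ->
      \int[prob_on_val rho]_(x in Y) f x =
        t * \int[prob_on_val mu]_(x in Y) f x +
        (1 - t) * \int[prob_on_val nu]_(x in Y) f x.
Proof.
move=> /andP[t0 t1]; have s0 : 0 <= 1 - t by rewrite subr_ge0.
have mY : measurable Y by exact: is_borel_compact.
pose m : {measure set X -> \bar R} := measure_add
  (mscale (NngNum t0) (prob_on_val mu)) (mscale (NngNum s0) (prob_on_val nu)).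
have mE A : m A = (t%:E * prob_on_val mu A + (1 - t)%:E * prob_on_val nu A)%E.
  exact: (measure_addE (mscale (NngNum t0) (prob_on_val mu))).
have mass A : prob_on_val mu A = 1%E -> prob_on_val nu A = 1%E -> m A = 1%E.
  by move=> mA nA; rewrite mE mA nA !mule1 -EFinD addrC subrK.
have mT : m setT = 1%E by apply: mass; exact: probability_setT.
pose p : probability X R := HB.pack (m : set X -> \bar R) m
  (Measure_isProbability.Build d X R m mT).
have pY : [set mu : pprobability X R | mu Y = 1%E] p.
  by apply: mass; exact: prob_on_valP.
exists (SigSub (mem_set pY)); split; first exact: mE.
move=> f cf; have [M M0 fM] := within_continuous_bounded cY cf.
have cfM : {within Y, continuous (fun x => 1 * (f x + M))}.
  exact: within_continuous_affine.
have mfM : measurable_fun Y (fun x => (1 * (f x + M))%:E).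
  by apply/measurable_EFinP; exact: within_continuous_measurable.
have fM0 x : Y x -> (0 <= (1 * (f x + M))%:E)%E.
  by move=> /fM; rewrite ler_norml lee_fin mul1r => /andP[]; lra.
have fin (q : prob_on Y) :
    (\int[prob_on_val q]_(x in Y) (1 * (f x + M))%:E)%E \is a fin_num.
  by apply: integrable_fin_num => //; exact: within_continuous_integrable.
have mI : (\int[m]_(x in Y) (1 * (f x + M))%:E =
    t%:E * \int[prob_on_val mu]_(x in Y) (1 * (f x + M))%:E +
    (1 - t)%:E * \int[prob_on_val nu]_(x in Y) (1 * (f x + M))%:E)%E.
  by rewrite ge0_integral_measure_add// !ge0_integral_mscale.
rewrite -(fineK (fin mu)) -(fineK (fin nu)) -!EFinM -EFinD in mI.
have E : \int[p]_(x in Y) (1 * (f x + M)) =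
    t * \int[prob_on_val mu]_(x in Y) (1 * (f x + M)) +
    (1 - t) * \int[prob_on_val nu]_(x in Y) (1 * (f x + M)) := congr1 fine mI.
rewrite !Rintegral_affine ?prob_on_valP// in E.
by apply: (addIr M); move: E; rewrite !mul1r => E; rewrite [LHS]E; ring.
Qed.

End mixture.

(** * From the bound for a single u to the rate function *)

Section upper_bound.
Context (R : realType) (d d' : measure_display)
    (X : measurableMetricType d R) (Omega : measurableType d')
    (K : R.-pker X ~> X) (P : X -> probability Omega R)
    (Z : nat -> {mfun Omega >-> X}) (Y Yt : set X) (C : set (prob_on Y)).
Hypotheses (sX : is_separable X) (bX : is_borel X) (mZ : is_markov_chain K P Z).
Hypothesis feller : forall u : X -> R, continuous u ->
  [bounded u x | x in [set: X]] -> continuous (transition_op P Z u).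
Hypotheses (Y0 : Y !=set0) (cY : compact Y) (mYt : measurable Yt) (YYt : Y `<=` Yt).
Hypothesis PYt : forall y, Y y -> P y (Z 1%N @^-1` Yt) = 1%E.
Hypotheses (clC : closed C) (cvxC : convex_prob C).
Variable n : nat.
Hypothesis n0 : (0 < n)%N.

Local Notation pi := (transition_op P Z).
Local Notation p := (ereal_inf [set P x (occupation_in Z n C) | x in Yt]).

Lemma occupation_inf_ge0 : (0 <= p)%E.
Proof. by apply: le_ereal_inf_tmp => _ [x _ <-]. Qed.

Lemma occupation_inf_le1 : (p <= 1)%E.
Proof.
have [y Yy] := Y0; apply: (@le_trans _ _ (P y (occupation_in Z n C))).
  by apply: ereal_inf_lbound; exists y => //; exact: YYt.
apply: probability_le1; rewrite (occupation_in_bigcup Z C bX cY n0).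
by apply: bigcup_measurable => t _; exact: measurable_path_occupation.
Qed.

(* Starting from an almost minimiser of u over Yt removes the constant
   sup u / inf u from the exponential Chebyshev bound. *)
Lemma occupation_inf_bound u a : S_star pi Y u ->
  (forall mu, C mu -> a <= \int[prob_on_val mu]_(x in Y) rate_integrand P Z u x) ->
  (p <= (expR (- (n%:R * a)))%:E)%E.
Proof.
move=> uS aC; have [cpu u0 _] := S_star_transition bX feller uS.
have [cu [c1 [c2 [c10 uc]]] upu] := uS.
have [y0 Yy0] := Y0; have Yty0 := YYt Yy0.
have hinf : has_inf [set u x | x in Yt].
  split; first by exists (u y0); exists y0.
  by exists c1 => _ [x _ <-]; have /andP[] := uc x.
pose c := inf [set u x | x in Yt].
have cu_le x : Yt x -> c <= u x.
  by move=> Ytx; apply: ge_inf; [case: hinf|exists x].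
have c1c : c1 <= c.
  by apply: lb_le_inf; [exists (u y0); exists y0|move=> _ [x _ <-]; have /andP[] := uc x].
have c0 : 0 < c by exact: lt_le_trans c1c.
have cpuY y : Y y -> c <= pi u y.
  move=> Yy; apply: (@transition_op_ge _ _ _ _ _ P Z u c2 c y Yt) => //.
  - exact: is_borel_continuous.
  - by move=> z; have /andP[h ->] := uc z; rewrite andbT (le_trans (ltW c10)).
  - exact: ltW.
  - exact: PYt.
have pfin : p \is a fin_num.
  by rewrite ge0_fin_numE ?occupation_inf_ge0// (le_lt_trans occupation_inf_le1)// ltry.
rewrite -(fineK pfin) lee_fin.
have b0 : 0 < c * expR (n%:R * a) by rewrite mulr_gt0// expR_gt0.
rewrite expRN -[leRHS]mul1r ler_pdivlMr ?expR_gt0// -(ler_pM2l c0) mulr1 mulrCA mulrC.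
apply/ler_addgt0Pr => e e0.
have [_ [x Ytx <-] ux] := inf_adherent e0 hinf.
apply: le_trans (ltW ux); rewrite -lee_fin.
apply: le_trans (occupation_bound mZ sX bX cY n0 clC cu c10 uc cpu upu (ltW c0) cpuY aC x).
rewrite EFinM fineK//; apply: lee_wpmul2l; first by rewrite lee_fin ltW.
by apply: ereal_inf_lbound; exists x.
Qed.

Lemma exists_rate_le a : (exists mu, C mu) ->
  (forall u, S_star pi Y u ->
    exists2 mu, C mu & \int[prob_on_val mu]_(x in Y) rate_integrand P Z u x < a) ->
  exists2 mu, C mu & forall u, S_star pi Y u ->
    \int[prob_on_val mu]_(x in Y) rate_integrand P Z u x <= a.
Proof.
move=> C0 fa; pose f (u : X -> R) (mu : prob_on Y) :=
  \int[prob_on_val mu]_(x in Y) rate_integrand P Z u x.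
have cr u : S_star pi Y u -> {within Y, continuous (rate_integrand P Z u)}.
  by move=> uS; apply: continuous_subspaceT; exact: (continuous_rate_integrand bX feller uS).
apply: (@minimax R (prob_on Y) (X -> R : choiceType) C (S_star pi Y) f a) => //.
- exact: (subclosed_compact clC (compact_prob_on bX cY)).
- move=> u uS; exact: (@continuous_test_integrals _ _ _ Y (exist _ _ (cr u uS))).
- move=> mu nu t Cmu Cnu /andP[t0 t1].
  (* The minimax puts weight 1 - t on mu, whereas the mixture gives its parameter to its first
     argument. *)
  have s01 : 0 <= 1 - t <= 1 by rewrite subr_ge0 t1/= lerBlDr lerDl.
  have [rho [rhoE rhoI]] := prob_on_mixture bX cY mu nu s01.
  exists rho; first exact: (cvxC s01 Cmu Cnu (fun A _ => rhoE A)).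
  move=> u uS; rewrite /f rhoI; last exact: cr.
  by ring.
- move=> s l sS l0 l1.
  exists (fun x => expR (\sum_(u <- s) l u * ln (u x))).
    exact: (log_mean_S_star mZ bX feller sS l0 l1).
  move=> mu Cmu; have csr : {in s, forall u, {within Y, continuous (rate_integrand P Z u)}}.
    by move=> u /sS; exact: cr.
  have [cs <-] := Rintegral_lincomb bX cY (prob_on_val mu) l csr.
  have mY : measurable Y by exact: is_borel_compact.
  apply: le_Rintegral => //; try exact: within_continuous_integrable.
    apply: within_continuous_integrable => //; apply: cr.
    exact: (log_mean_S_star mZ bX feller sS l0 l1).
  by move=> x _; exact: (rate_integrand_concave mZ bX feller sS l0 l1).
Qed.

(** The rate is an infimum of extended integrals of ln(pi u / u). These are finite, the integrand
    being continuous on the compact Y, so each is minus the real integral of [rate_integrand]. *)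
Lemma rate_le (mu : prob_on Y) a : (forall u, S_star pi Y u ->
    \int[prob_on_val mu]_(x in Y) rate_integrand P Z u x <= a) ->
  (rate pi mu <= a%:E)%E.
Proof.
move=> ha; rewrite /rate leeNl -EFinN; apply: le_ereal_inf_tmp => _ [u uS <-].
have cr : {within Y, continuous (rate_integrand P Z u)}.
  by apply: continuous_subspaceT; exact: (continuous_rate_integrand bX feller uS).
have cln : {within Y, continuous (fun x => -1 * (rate_integrand P Z u x + 0))}.
  exact: within_continuous_affine.
have E : (fun x => ln (pi u x / u x)) = (fun x => -1 * (rate_integrand P Z u x + 0)).
  by apply/funext => x; rewrite addr0 mulN1r opprK.
have mY : measurable Y by exact: is_borel_compact.
have -> : (\int[prob_on_val mu]_(x in Y) (ln (pi u x / u x))%:E =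
    (\int[prob_on_val mu]_(x in Y) (-1 * (rate_integrand P Z u x + 0)))%:E)%E.
  rewrite /Rintegral fineK; first by apply: eq_integral => x _; rewrite -[LHS]/((fun x => ln (pi u x / u x)) x)%:E E.
  by apply: integrable_fin_num => //; exact: within_continuous_integrable.
rewrite Rintegral_affine ?prob_on_valP// addr0 mulN1r lee_fin lerN2.
exact: ha.
Qed.

(** By contradiction: write the infimum p as exp(-n b) with b below inf I, and take a real a
    strictly between them. Either some u has integral at least a on all of C, whence p is at most
    exp(-n a) < exp(-n b), or the minimax produces mu in C with I(mu) at most a. *)
Lemma occupation_upper_bound :
  (p <= expeR (- (n%:R%:E * ereal_inf [set rate pi mu | mu in C])))%E.
Proof.
set I0 := ereal_inf [set rate pi mu | mu in C].
(* For empty C the event is empty too, so p is at most 0. *)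
have [C0|nC] := pselect (exists mu, C mu); last first.
  have [y Yy] := Y0; apply: (@le_trans _ _ 0%E); last exact: expeR_ge0.
  apply: (@le_trans _ _ (P y (occupation_in Z n C))).
    by apply: ereal_inf_lbound; exists y => //; exact: YYt.
  have -> : occupation_in Z n C = set0; last by rewrite measure0.
  by apply/seteqP; split => // w [mu Cmu _]; apply: nC; exists mu.
rewrite leNgt; apply/negP => lt.
have pfin : p \is a fin_num.
  by rewrite ge0_fin_numE ?occupation_inf_ge0// (le_lt_trans occupation_inf_le1)// ltry.
have nR : 0 < n%:R :> R by rewrite ltr0n.
pose r := fine p; have rE : r%:E = p by exact: fineK.
have r0 : 0 < r by rewrite -lte_fin rE; apply: le_lt_trans lt; exact: expeR_ge0.
pose b := - ln r / n%:R.
have rb : r = expR (- (n%:R * b)).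
  by rewrite /b mulrCA divff ?gt_eqF// mulr1 opprK lnK.
have bI : (b%:E < I0)%E.
  rewrite ltNge; apply/negP => I0b; move: lt; rewrite ltNge => /negP; apply.
  rewrite -rE rb -[X in (X <= _)%E]/(expeR (- (n%:R * b))%:E) lee_expeR.
  by rewrite EFinN leeN2 EFinM lee_wpmul2l// lee_fin ltW.
(* Infinite inf I is a separate case, because the minimax needs a finite threshold. *)
have [a [ba aI]] : exists a : R, b < a /\ (a%:E < I0)%E.
  case: I0 bI {lt} => [i| |] //.
    rewrite lte_fin => bi; exists ((b + i) / 2); rewrite lte_fin.
    by split; lra.
  by move=> _; exists (b + 1); rewrite ltrDl ltr01 ltry.
have [|mu Cmu hmu] := @exists_rate_le a C0.
  move=> u uS; apply: contrapT => nu.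
  have : (p <= (expR (- (n%:R * a)))%:E)%E.
    apply: (occupation_inf_bound uS) => mu Cmu; rewrite leNgt; apply/negP => lta.
    by apply: nu; exists mu.
  by rewrite -rE lee_fin rb ler_expR lerN2 ler_pM2l// leNgt ba.
have := rate_le hmu; apply/negP; rewrite -ltNge; apply: lt_le_trans aI _.
by apply: ereal_inf_lbound; exists mu.
Qed.

End upper_bound.

Theorem mainTheorem1 (R : realType) (d d' : measure_display)
    (X : measurableMetricType d R) (Omega : measurableType d')
    (K : R.-pker X ~> X) (P : X -> probability Omega R)
    (Z : nat -> {mfun Omega >-> X}) (Y Yt : set X) (C : set (prob_on Y)) :
  is_separable X -> is_borel X ->
  is_markov_chain K P Z ->
  (forall u : X -> R, continuous u -> [bounded u x | x in [set: X]] ->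
     continuous (transition_op P Z u)) ->
  Y !=set0 -> compact Y ->
  measurable Yt -> Y `<=` Yt ->
  (forall y, Y y -> P y (Z 1%N @^-1` Yt) = 1%E) ->
  closed C -> convex_prob C ->
  forall n : nat, (1 <= n)%N ->
    (ereal_inf [set P x (occupation_in Z n C) | x in Yt] <=
     expeR (- (n%:R%:E * ereal_inf [set rate (transition_op P Z) mu
                                   | mu in C])))%E.
Proof. by move=> *; apply: occupation_upper_bound; eassumption. Qed.
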